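(* Let $d\in\{1,2,3\}$, let $\mu$ be an offspring distribution and $\theta$ a jump distribution on $\mathbb{Z}^d$ satisfying the assumptions stated in the context, with $\rho=(\operatorname{var}\mu)^{1/2}$ and $M_\theta$ the covariance matrix of $\theta$. Under the probability measure $\Pi^*_{\mu,\theta}$, let $(\mathcal{T},(z_u)_{u\in\mathcal{T}})$ be the random walk with jump distribution $\theta$, started from $0$, indexed by the (unconditioned) Galton--Watson tree $\mathcal{T}$ with offspring distribution $\mu$, and let $\mathbf{R}=\{z_u:u\in\mathcal{T}\}$ be the set of all points it visits. Then $$\lim_{|a|\to\infty,\ a\in\mathbb{Z}^d}\bigl|M_\theta^{-1/2}a\bigr|^2\,\Pi^*_{\mu,\theta}(a\in\mathbf{R})=\frac{2(4-d)}{\rho^2}.$$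
   Context: Assumptions on $\mu$ and $\theta$: $\mu$ is a nondegenerate critical (mean one) offspring distribution on $\mathbb{Z}_+$ such that $\sum_{k\ge0}e^{\lambda k}\mu(k)<\infty$ for some $\lambda>0$; $\rho:=(\operatorname{var}\mu)^{1/2}>0$. $\theta$ is a probability measure on $\mathbb{Z}^d$, not supported on a strict subgroup of $\mathbb{Z}^d$, with zero mean, and $\lim_{r\to\infty}r^4\,\theta(\{x\in\mathbb{Z}^d:|x|>r\})=0$. $M_\theta^{1/2}$ is the positive definite symmetric square root of $M_\theta$ and $M_\theta^{-1/2}=(M_\theta^{1/2})^{-1}$. Under $\Pi^*_{\mu,\theta}$, $\mathcal{T}$ is a (finite rooted ordered) Galton--Watson tree with offspring distribution $\mu$; conditionally on $\mathcal{T}$, the root $\varnothing$ has $z_\varnothing=0$ and the increments $z_u-z_{\check u}$, $u$ ranging over non-root vertices with parent $\check u$, are independent with law $\theta$. *)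

(* Defs.v *)
From HB Require Import structures.
From mathcomp Require Import all_boot all_order all_algebra.
From mathcomp Require Import all_classical all_reals all_analysis.

Set Implicit Arguments.
Unset Strict Implicit.
Unset Printing Implicit Defensive.

Import Order.TTheory GRing.Theory Num.Theory.
Import numFieldNormedType.Exports.

Local Open Scope classical_set_scope.
Local Open Scope ring_scope.

(* The lattice Z^d, as integer column vectors, carries the discrete
   sigma-algebra. *)
Notation Zd d := 'cV[int]_d.

HB.instance Definition _ := isPointed.Build int 0.
HB.instance Definition _ (d : nat) := @isMeasurable.Build
  default_measure_display 'cV[int]_d discrete_measurable discrete_measurable0
  discrete_measurableC discrete_measurableU.

Definition Zd_to_R (R : realType) (d : nat) (x : Zd d) : 'cV[R]_d :=
  map_mx intr x.

(* Euclidean norm; the library norm on matrices is the sup norm. *)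
Definition enorm (R : realType) (d : nat) (v : 'cV[R]_d) : R :=
  Num.sqrt (\sum_i v i 0 ^+ 2).

(* The filter "|a| -> oo, a in Z^d". *)
Definition Zd_infty (R : realType) (d : nat) : set_system (Zd d) :=
  filter_from [set: R] (fun r => [set a | r < enorm (Zd_to_R R a)]).
Arguments Zd_infty R d : clear implicits.

#[export] Instance Zd_infty_filter (R : realType) (d : nat) :
  Filter (Zd_infty R d).
Proof.
apply: filter_from_filter; first by exists 0.
move=> r s _ _; exists (Num.max r s) => // a /=.
by rewrite gt_max => /andP[].
Qed.

Definition posdefmx (R : realType) (d : nat) (S : 'M[R]_d) : Prop :=
  forall v : 'cV[R]_d, v != 0 -> 0 < (v^T *m S *m v) 0 0.

(* The positive definite symmetric square root of M (0 if there is none). *)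
Definition sqrtmx (R : realType) (d : nat) (M : 'M[R]_d) : 'M[R]_d :=
  xget 0 [set S | [/\ S^T = S, posdefmx S & S *m S = M]].

Section offspring_distribution.
Context (R : realType) (mu : probability nat R).

Definition rho : R := Num.sqrt (fine 'V_mu[fun k : nat => k%:R]%E).

Record offspring_assumptions : Prop := {
  offspring_nondegenerate : forall k : nat, mu [set k] != 1%E ;
  offspring_critical : ('E_mu[fun k : nat => k%:R] = 1)%E ;
  offspring_exp_moment : exists2 l : R, 0 < l &
    (\sum_(0 <= k <oo) (expR (l * k%:R))%:E * mu [set k] < +oo)%E ;
  offspring_rho_gt0 : 0 < rho }.

End offspring_distribution.

Section jump_distribution.
Context (R : realType) (d : nat) (theta : probability (Zd d) R).

Definition coord (i : 'I_d) (x : Zd d) : R := (x i 0)%:~R.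

Definition cov_mx : 'M[R]_d :=
  \matrix_(i, j) fine (covariance theta (coord i) (coord j)).

Record jump_assumptions : Prop := {
  jump_not_in_strict_subgroup : forall H : {pred Zd d}, zmod_closed H ->
    theta [set x | x \in H] = 1%E -> H =i predT ;
  jump_centered : forall i, ('E_theta[coord i] = 0)%E ;
  jump_tail :
    r ^+ 4 * fine (theta [set x | r < enorm (Zd_to_R R x)])
      @[r --> +oo] --> (0 : R) }.

End jump_distribution.

(* A finite rooted ordered tree T together with the positions (z_u) of its
   vertices: [SNode x s] has its root at x, and s lists, in order, the spatial
   subtrees of descendants of the children of the root. *)
Inductive spatial_tree (d : nat) := SNode of Zd d & seq (spatial_tree d).

Section spatial_tree.
Context (d : nat).
Implicit Type t : spatial_tree d.

Fixpoint tree_code t : GenTree.tree (Zd d) :=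
  let: SNode x s := t in GenTree.Node 0 (GenTree.Leaf x :: map tree_code s).

Fixpoint tree_decode (g : GenTree.tree (Zd d)) : option (spatial_tree d) :=
  if g is GenTree.Node _ (GenTree.Leaf x :: s) then
    Some (SNode x (pmap id (map tree_decode s)))
  else None.

Lemma tree_codeK : pcancel tree_code tree_decode.
Proof.
rewrite /pcancel; fix IH 1 => -[x s] /=; congr (Some (SNode _ _)).
elim: s => [//|t s IHs] /=.
by rewrite (IH t) /= IHs.
Qed.

Definition root_pos t : Zd d := let: SNode x _ := t in x.

(* The numbers of children k_u, u in T. *)
Fixpoint offspring t : seq nat :=
  let: SNode _ s := t in size s :: flatten (map offspring s).

(* The differences between the position of u and that of its parent, u in T
   not the root. *)
Fixpoint increments t : seq (Zd d) :=
  let: SNode x s := t in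
  flatten (map (fun t' => (root_pos t' - x) :: increments t') s).

(* The positions z_u, u in T. *)
Fixpoint positions t : seq (Zd d) :=
  let: SNode x s := t in x :: flatten (map positions s).

Definition visited t : set (Zd d) := [set a | a \in positions t].

End spatial_tree.

HB.instance Definition _ (d : nat) :=
  Countable.copy (spatial_tree d) (pcan_type (@tree_codeK d)).
HB.instance Definition _ (d : nat) :=
  isPointed.Build (spatial_tree d) (SNode 0 [::]).
HB.instance Definition _ (d : nat) := @isMeasurable.Build
  default_measure_display (spatial_tree d) discrete_measurable
  discrete_measurable0 discrete_measurableC discrete_measurableU.

Section Pi_star.
Context (R : realType) (d : nat).
Context (mu : probability nat R) (theta : probability (Zd d) R).

(* The Galton-Watson law gives T the probability \prod_u mu(k_u); given T,
   the root sits at 0 and the increments along the edges are independent with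
   law theta. *)
Definition spatial_weight (t : spatial_tree d) : R :=
  \prod_(k <- offspring t) fine (mu [set k]) *
  ((root_pos t == 0)%:R * \prod_(x <- increments t) fine (theta [set x])).

(* The total mass is the extinction probability of the Galton-Watson process,
   which is 1 for a nondegenerate critical mu. *)
Definition Pi_star (A : set (spatial_tree d)) : \bar R :=
  \esum_(t in A) (spatial_weight t)%:E.

Lemma spatial_weight_ge0 t : 0 <= spatial_weight t.
Proof.
rewrite /spatial_weight !mulr_ge0 ?ler0n// big_seq prodr_ge0// => i _;
exact: fine_ge0.
Qed.

Lemma Pi_star_set0 : Pi_star set0 = 0%E.
Proof. exact: esum_set0. Qed.

Lemma Pi_star_ge0 A : (0 <= Pi_star A)%E.
Proof. by apply: esum_ge0 => t _; rewrite lee_fin spatial_weight_ge0. Qed.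

Lemma Pi_star_semi_sigma_additive : semi_sigma_additive Pi_star.
Proof.
move=> F mF tF mUF; rewrite /Pi_star esum_bigcupT//; last first.
  by move=> t; rewrite lee_fin spatial_weight_ge0.
rewrite -nneseries_esumT; last by move=> n; exact: Pi_star_ge0.
by apply: is_cvg_nneseries => n _ _; exact: Pi_star_ge0.
Qed.

HB.instance Definition _ := isMeasure.Build _ _ _ Pi_star
  Pi_star_set0 Pi_star_ge0 Pi_star_semi_sigma_additive.

End Pi_star.

(* Main.v *)
(* Let [u a] be the probability that [a] is visited. Decomposing at the root
   gives, by translation invariance, [u 0 = 1] and [u a = G (E (u (a - Y)))] for
   [a != 0], where [Y] has law [theta] and [G s = 1 - phi (1 - s)] with [phi]
   the generating function of [mu]. As [G] is nondecreasing, subadditive and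
   [G s < s] for [s > 0], there is a comparison principle between sub- and
   supersolutions of this equation, so that explicit barriers replace the
   analysis of the Green function.

   Put [N a = |M_theta^(-1/2) a|^2] and [c = 2 * (4 - d) / rho ^+ 2]. A step of
   the walk raises [1 / N] by [(4 - d) / N ^+ 2] on average, while
   [s - G s ~ rho ^+ 2 / 2 * s ^+ 2]; hence [c * (1 + e) / N] and
   [c * (1 - e) / N], with lower-order corrections, are respectively a
   supersolution and a subsolution. Large jumps contribute [o(1 / N ^+ 2)] by
   the fourth-order tail hypothesis. Matching the lower barrier near the origin
   requires [u > 0] everywhere: a centred [theta] whose support generates [Z^d]
   as a group also generates it as a semigroup. *)

Require Import Defs.
From HB Require Import structures.
From mathcomp Require Import all_boot all_order all_algebra.
From mathcomp Require Import all_classical all_reals all_analysis.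
From mathcomp Require spectral complex.
From mathcomp Require Import zify ring lra.
Import Order.TTheory GRing.Theory Num.Theory.
Import numFieldNormedType.Exports.
Local Open Scope classical_set_scope.
Local Open Scope ring_scope.
Set Implicit Arguments.
Unset Strict Implicit.
Unset Printing Implicit Defensive.

(** Increments are controlled only where [N] is large, so each barrier carries a correction of order
    [N ^ (-5/4)] whose coefficient is made large enough to settle the region near the origin. The
    corrected barrier must stay a super- or subsolution however large this coefficient is, and this
    dictates the exponent. If [A / N] is perturbed by [B / N ^ k], the drift multiplies the
    correction by [2 * k * (k + 1) - k * D], while the cross term of the quadratic loss multiplies
    it by about [2 * (4 - D)]. One thus needs [k > 1] with the first factor below the second; for
    [D = 3] the value [5/4] works, with margin [1/8], and [4/3] does not. The lower barrier
    [A / (N + K * N ^ (3/4))] has a correction of the same order and stays positive for every [K].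
    Quarter powers also keep the analysis algebraic: with [s] the fourth root of [N (x - y) / N x],
    every Taylor bound is a polynomial inequality in [s]. The comparison principle does two more
    jobs: it shows that the tree law has total mass one, and that the probability of reaching [a]
    from [a - z] depends on [z] only. *)

(** * Expectations on a space where every set is measurable *)

Section discrete_probability.
Context {disp : measure_display} {T : measurableType disp} {R : realType}.
Hypothesis mT : forall A : set T, measurable A.
Variable P : probability T R.
Implicit Types f g : T -> R.

Local Notation ig f := (P.-integrable setT (EFin \o f)).

Lemma le_ig f g : (forall x, `|f x| <= g x) -> ig g -> ig f.
Proof.
move=> fg; apply: le_integrable; [by []|by move=> ? ? ?; exact: mT|].
move=> x _ /=; rewrite lee_fin (le_trans (fg x))//; exact: ler_norm.
Qed.

Lemma ig_cst c : ig (cst c).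
Proof.
by apply: finite_measure_integrable_cst; exact: measurableT.
Qed.

Lemma ig_bounded c f : (forall x, `|f x| <= c) -> ig f.
Proof. move=> fc; exact: le_ig fc (ig_cst c). Qed.

Lemma igD f g : ig f -> ig g -> ig (fun x => f x + g x).
Proof. by move=> hf hg; have := integrableD measurableT hf hg. Qed.

Lemma igN f : ig f -> ig (fun x => - f x).
Proof. by move=> hf; have := integrableN hf. Qed.

Lemma igB f g : ig f -> ig g -> ig (fun x => f x - g x).
Proof. by move=> hf hg; apply: igD => //; exact: igN. Qed.

Lemma igZ c f : ig f -> ig (fun x => c * f x).
Proof. by move=> hf; have := integrableZl measurableT c hf. Qed.

Lemma ig_sum I (s : seq I) (F : I -> T -> R) : (forall i, ig (F i)) ->
  ig (fun x => \sum_(i <- s) F i x).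
Proof.
move=> hF; elim: s => [|i s IH].
  by under eq_fun do rewrite big_nil; exact: ig_cst.
by under eq_fun do rewrite big_cons; exact: igD.
Qed.

Lemma ED f g : ig f -> ig g ->
  \int[P]_x (f x + g x) = \int[P]_x f x + \int[P]_x g x.
Proof. exact: (RintegralD measurableT). Qed.

Lemma EB f g : ig f -> ig g ->
  \int[P]_x (f x - g x) = \int[P]_x f x - \int[P]_x g x.
Proof. exact: (RintegralB measurableT). Qed.

Lemma EZ c f : ig f -> \int[P]_x (c * f x) = c * \int[P]_x f x.
Proof. exact: (RintegralZl _ measurableT). Qed.

Lemma Ecst c : \int[P]_x (cst c x) = c.
Proof.
rewrite -[RHS]mulr1 [LHS](Rintegral_cst _ measurableT).
by congr (_ * _); exact: (congr1 fine (probability_setT P)).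
Qed.

Lemma E_le f g : ig f -> ig g -> (forall x, f x <= g x) ->
  \int[P]_x f x <= \int[P]_x g x.
Proof. by move=> hf hg fg; apply: (le_Rintegral measurableT hf hg). Qed.

Lemma E_sum I (s : seq I) (F : I -> T -> R) : (forall i, ig (F i)) ->
  \int[P]_x (\sum_(i <- s) F i x) = \sum_(i <- s) \int[P]_x F i x.
Proof.
move=> hF; elim: s => [|i s IH].
  rewrite big_nil -[RHS](Ecst 0); apply: eq_Rintegral => x _.
  by rewrite big_nil.
rewrite big_cons -IH -ED//; last exact: ig_sum.
by apply: eq_Rintegral => x _; rewrite big_cons.
Qed.

Lemma E_in01 f : (forall x, 0 <= f x <= 1) -> 0 <= \int[P]_x f x <= 1.
Proof.
move=> f01; rewrite Rintegral_ge0//=; last by move=> x _; case/andP: (f01 x).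
rewrite -[leRHS](Ecst 1); apply: E_le; last by move=> x; case/andP: (f01 x).
- apply: (ig_bounded (c := 1)) => x; case/andP: (f01 x) => ? ?.
  by rewrite ger0_norm.
- exact: ig_cst.
Qed.

End discrete_probability.

(** * The generating function of the offspring distribution *)

Section power_remainder.
Context {R : realType}.
Implicit Types s : R.

(* [rem2 k s] is the second-order Taylor remainder of [(1 - s) ^+ k] at [s = 0],
   divided by [s ^+ 2]. *)
Fixpoint rem2 (k : nat) s : R :=
  if k is k'.+1 then k'%:R + (1 - s) * rem2 k' s else 0.

Lemma rem2E k s : (1 - s) ^+ k = 1 - k%:R * s + s ^+ 2 * rem2 k s.
Proof.
elim: k => [|k IH] /=; first by rewrite expr0; ring.
by rewrite exprS IH -natr1; ring.
Qed.

Lemma rem2_ge0 k s : 0 <= s <= 1 -> 0 <= rem2 k s.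
Proof.
case/andP=> s0 s1; elim: k => //= k IH.
by rewrite addr_ge0// mulr_ge0// subr_ge0.
Qed.

Lemma rem2_anti k s t : 0 <= s -> s <= t -> t <= 1 -> rem2 k t <= rem2 k s.
Proof.
move=> s0 st t1; elim: k => //= k IH.
by rewrite lerD2l ler_pM ?subr_ge0 ?lerB// rem2_ge0// t1 (le_trans s0).
Qed.

Lemma rem2_0 k : rem2 k 0 = ((k%:R - 1) ^+ 2 + (k%:R - 1)) / 2 :> R.
Proof.
elim: k => [|k IH] /=; first by field.
by rewrite IH -natr1; field.
Qed.

(** For [k > 0], multiply by [s] and bound [(1 - s) ^+ k] by [1 - s] in [rem2E]. Once integrated,
    this carries positivity of [genrem] from small arguments to 1, where it is smallest on the unit
    interval. *)
Lemma rem2_1 k s : 0 < s <= 1 -> s * rem2 k s <= rem2 k 1.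
Proof.
case/andP=> s0 s1; case: k => [|k] /=; first by rewrite mulr0.
rewrite subrr mul0r addr0 -(ler_pM2l s0) mulrA -expr2.
have := rem2E k.+1 s; rewrite /= => /(canLR (addKr _)) <-.
have : (1 - s) ^+ k.+1 <= 1 - s.
  by rewrite exprS ler_piMr ?subr_ge0// exprn_ile1 ?subr_ge0 ?gerBl ?(ltW s0).
rewrite -natr1; lra.
Qed.

Lemma rem2_cvg k : (fun n => rem2 k (n.+1%:R^-1)) @ \oo --> rem2 k 0.
Proof.
elim: k => [|k IH] /=; first exact: cvg_cst.
apply: cvgD; first exact: cvg_cst.
apply: cvgM => //; apply: cvgB; first exact: cvg_cst.
exact: cvg_harmonic.
Qed.

(** The reason is the concavity of [1 - (1 - s) ^+ k], which vanishes at 0; averaging over [k] gives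
    [hitfun_subadd]. *)
Lemma exprB_subadd k (a b : R) : 0 <= a -> 0 <= b -> a + b <= 1 ->
  (1 - a) ^+ k + (1 - b) ^+ k <= 1 + (1 - (a + b)) ^+ k.
Proof.
move=> a0 b0 ab.
have y0 : 0 <= 1 - (a + b) by lra.
have z0 : 1 - (a + b) <= 1 - b by lra.
elim: k => [|k IH]; first by rewrite !expr0.
rewrite !exprS.
have xk1 : (1 - a) ^+ k <= 1 by rewrite exprn_ile1//; lra.
have yk0 : 0 <= (1 - (a + b)) ^+ k by rewrite exprn_ge0.
have yz : (1 - (a + b)) ^+ k <= (1 - b) ^+ k by rewrite lerXn2r ?nnegrE//; lra.
have xy : (1 - (a + b)) ^+ k <= (1 - a) ^+ k by rewrite lerXn2r ?nnegrE//; lra.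
have zk1 : (1 - b) ^+ k <= 1 by rewrite exprn_ile1//; lra.
move: IH xk1 yk0 yz xy zk1.
move: ((1 - a) ^+ k) ((1 - b) ^+ k) ((1 - (a + b)) ^+ k) => x z y.
nra.
Qed.

End power_remainder.

Lemma nat_measurable (A : set nat) : measurable A.
Proof. by []. Qed.

Section offspring_functional.
Context {R : realType}.
Variable mu : probability nat R.
Hypothesis hmu : offspring_assumptions mu.

Local Notation ig f := (mu.-integrable setT (EFin \o f)).
Local Notation mN := nat_measurable.
Local Notation rho := (rho mu).

Lemma offspring_variance :
  ('V_mu[fun k : nat => k%:R] = \int[mu]_k ((k%:R - 1) ^+ 2)%:E)%E.
Proof.
have := congr1 fine (offspring_critical hmu); rewrite unlock => h.
rewrite /variance 2!unlock; apply: eq_integral => k _; rewrite expr2.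
by congr (_ * _)%:E; congr (_ - _); exact: h.
Qed.

Lemma ig_offspring_sq : ig (fun k : nat => (k%:R - 1) ^+ 2).
Proof.
apply/integrableP; split; first by move=> ? ? ?; exact: mN.
under eq_integral => k _.
  rewrite /= ger0_norm ?sqr_ge0//; over.
rewrite -offspring_variance.
have := offspring_rho_gt0 hmu; rewrite /rho sqrtr_gt0.
(* [fine] sends infinite values to 0, so [0 < rho] excludes an infinite variance. *)
by case: ('V_mu[_])%E => [r|//|/=]; rewrite ?ltry// ltxx.
Qed.

Lemma rhoE : \int[mu]_k ((k%:R - 1) ^+ 2) = rho ^+ 2.
Proof.
rewrite /rho sqr_sqrtr; first by rewrite offspring_variance.
by have := offspring_rho_gt0 hmu; rewrite /rho sqrtr_gt0 => /ltW.
Qed.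

Lemma ig_offspring : ig (fun k : nat => k%:R).
Proof.
apply: (le_ig mN (g := fun k => (k%:R - 1) ^+ 2 + cst 2 k)).
  move=> k; rewrite /= ger0_norm//; have : 0 <= k%:R :> R by [].
  by have := sqr_ge0 (2 * k%:R - 3 : R); nra.
exact: (igD ig_offspring_sq (ig_cst mu 2)).
Qed.

Lemma offspring_mean : \int[mu]_k k%:R = 1.
Proof. by have := congr1 fine (offspring_critical hmu); rewrite unlock. Qed.

Lemma ig_rem2 s : 0 <= s <= 1 -> ig (fun k => rem2 k s).
Proof.
move=> s01; have [s0 s1] := andP s01.
apply: (le_ig mN (g := fun k => (k%:R - 1) ^+ 2 + k%:R)).
  move=> k; rewrite ger0_norm ?rem2_ge0//.
  apply: (le_trans (rem2_anti k (lexx 0) s0 s1)); rewrite rem2_0.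
  by have := sqr_ge0 (k%:R - 1 : R); have : 0 <= k%:R :> R by []; lra.
exact: (igD ig_offspring_sq ig_offspring).
Qed.

Definition genrem s : R := \int[mu]_k rem2 k s.

(* Writing [phi] for the generating function of [mu], this is
   [1 - phi (1 - s)]: see [hitfunE]. *)
Definition hitfun s : R := s - s ^+ 2 * genrem s.

Lemma genrem_anti s t : 0 <= s -> s <= t -> t <= 1 -> genrem t <= genrem s.
Proof.
move=> s0 st t1; apply: E_le.
- by apply: ig_rem2; rewrite t1 (le_trans s0).
- by apply: ig_rem2; rewrite s0 (le_trans st).
- by move=> k; apply: rem2_anti.
Qed.

Lemma genrem0 : genrem 0 = rho ^+ 2 / 2.
Proof.
rewrite /genrem.
transitivity (\int[mu]_k (2^-1 * ((k%:R - 1) ^+ 2 + (k%:R - cst 1 k)))).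
  by apply: eq_Rintegral => k _; rewrite rem2_0 mulrC.
have ig1 : ig (fun k : nat => k%:R - cst 1 k : R).
  exact: (igB ig_offspring (ig_cst mu 1)).
rewrite EZ; last exact: (igD ig_offspring_sq ig1).
rewrite ED ?EB ?Ecst ?offspring_mean ?rhoE ?subrr ?addr0 1?mulrC//.
- exact: ig_offspring.
- exact: ig_cst.
- exact: ig_offspring_sq.
Qed.

(** Dominated convergence, with [rem2 k 0] as the dominating function. A single sequence is enough
    because [genrem] is monotone. *)
Lemma genrem_cvg : (fun n => genrem n.+1%:R^-1) @ \oo --> genrem 0.
Proof.
have i01 n : 0 <= (n.+1%:R^-1 : R) <= 1 by rewrite invr_ge0 ler0n/= invf_le1 ?ler1n.
have [] := @dominated_convergence _ _ _ mu setT measurableT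
  (fun n k => (rem2 k (n.+1%:R^-1))%:E) (fun k => (rem2 k 0)%:E)
  (fun k => (rem2 k 0)%:E).
- by move=> n ? ? ?; exact: mN.
- by move=> ? ? ?; exact: mN.
- apply: aeW => k _; apply: cvg_EFin; first by apply: nearW => n.
  exact: rem2_cvg.
- by apply: ig_rem2; rewrite lexx ler01.
- apply: aeW => k n _; rewrite lee_fin ger0_norm ?rem2_ge0//.
  by have /andP[? ?] := i01 n; exact: rem2_anti.
move=> _ _ h; apply: fine_cvg; rewrite fineK//.
by apply: integrable_fin_num => //; apply: ig_rem2; rewrite lexx ler01.
Qed.

Lemma genrem_near0 e : 0 < e ->
  exists2 s0, 0 < s0 <= 1 & forall s, 0 <= s <= s0 -> rho ^+ 2 / 2 - e <= genrem s.
Proof.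
move=> e0; have /cvgrPdist_le/(_ e e0)[n _ /(_ n (leqnn _))] := genrem_cvg.
rewrite genrem0 => /ler_normlP[_ h].
have n01 : 0 < (n.+1%:R^-1 : R) <= 1 by rewrite invr_gt0 ltr0n/= invf_le1 ?ler1n.
exists n.+1%:R^-1 => // s /andP[s0 sn].
have := genrem_anti s0 sn (proj2 (andP n01)).
by move: h; rewrite [X in X <= e]addrC; lra.
Qed.

Lemma genrem1_gt0 : 0 < genrem 1.
Proof.
have r0 : 0 < rho := offspring_rho_gt0 hmu.
have e0 : 0 < rho ^+ 2 / 4 by have := exprn_gt0 2 r0; lra.
have [s /andP[s0 s1] hs] := genrem_near0 e0.
have := hs s; rewrite (ltW s0) lexx => /(_ isT) h.
have s01 : 0 <= s <= 1 by rewrite (ltW s0).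
have : s * genrem s <= genrem 1.
  rewrite -EZ//; last exact: ig_rem2.
  apply: E_le.
  - by apply: igZ => //; exact: ig_rem2.
  - by apply: ig_rem2; rewrite ler01 lexx.
  - by move=> k; apply: rem2_1; rewrite s0.
apply: lt_le_trans; rewrite mulr_gt0//; apply: lt_le_trans h.
by have := exprn_gt0 2 r0; lra.
Qed.

Lemma ig_pow s : 0 <= s <= 1 -> ig (fun k : nat => (1 - s) ^+ k).
Proof.
case/andP=> s0 s1; apply: (@ig_bounded _ _ _ mN mu 1) => k.
by rewrite ger0_norm ?exprn_ge0 ?exprn_ile1 ?subr_ge0 ?gerBl.
Qed.

Lemma hitfunE s : 0 <= s <= 1 -> hitfun s = 1 - \int[mu]_k ((1 - s) ^+ k).
Proof.
move=> s01.
have i1 : ig (fun k : nat => cst 1 k - s * k%:R : R).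
  exact: (igB (ig_cst mu 1) (igZ s ig_offspring)).
have -> : \int[mu]_k ((1 - s) ^+ k) =
    \int[mu]_k ((cst 1 k - s * k%:R) + s ^+ 2 * rem2 k s).
  by apply: eq_Rintegral => k _; rewrite rem2E mulrC [s * _]mulrC.
rewrite ED ?EB ?Ecst ?EZ ?offspring_mean//.
- by rewrite /hitfun /genrem; ring.
- exact: ig_rem2.
- exact: ig_offspring.
- exact: ig_cst.
- by apply: igZ; exact: ig_offspring.
- by apply: igZ; exact: ig_rem2.
Qed.

Lemma hitfun0 : hitfun 0 = 0.
Proof. by rewrite /hitfun; ring. Qed.

Lemma hitfun_le s t : 0 <= s -> s <= t -> t <= 1 -> hitfun s <= hitfun t.
Proof.
move=> s0 st t1.
have s01 : 0 <= s <= 1 by rewrite s0 (le_trans st).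
have t01 : 0 <= t <= 1 by rewrite (le_trans s0).
rewrite !hitfunE// lerD2l lerN2; apply: E_le; [exact: ig_pow|exact: ig_pow|].
by move=> k; rewrite lerXn2r ?nnegrE ?subr_ge0// ?lerD2l ?lerN2//; lra.
Qed.

Lemma hitfun_subadd a b : 0 <= a -> 0 <= b -> a + b <= 1 ->
  hitfun (a + b) <= hitfun a + hitfun b.
Proof.
move=> a0 b0 ab.
rewrite !hitfunE; [|lra..].
have ia : ig (fun k : nat => (1 - a) ^+ k) by apply: ig_pow; lra.
have ib : ig (fun k : nat => (1 - b) ^+ k) by apply: ig_pow; lra.
have iab : ig (fun k : nat => (1 - (a + b)) ^+ k) by apply: ig_pow; lra.
have := E_le (igD ia ib) (igD (ig_cst mu 1) iab)
  (fun k => exprB_subadd k a0 b0 ab).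
by rewrite !ED ?Ecst//; [lra|exact: ig_cst].
Qed.

Lemma hitfun_ge_id_eq0 s : 0 <= s <= 1 -> s <= hitfun s -> s = 0.
Proof.
case/andP=> s0 s1; rewrite /hitfun.
have := genrem_anti s0 s1 (lexx 1); have := genrem1_gt0.
move=> ? ? h; apply/eqP; rewrite -sqrf_eq0; apply/eqP/le_anti.
rewrite sqr_ge0 andbT; have : 0 < genrem s by lra.
by move: h; rewrite expr2; nra.
Qed.

Lemma hitfun_ge s : 0 <= s <= 1 -> s - rho ^+ 2 / 2 * s ^+ 2 <= hitfun s.
Proof.
case/andP=> s0 s1; rewrite /hitfun lerD2l lerN2 mulrC -genrem0.
by rewrite ler_wpM2r ?sqr_ge0// genrem_anti.
Qed.

Lemma hitfun_gt0 s : 0 < s <= 1 -> 0 < hitfun s.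
Proof.
case/andP=> s0 s1.
have r0 : 0 < rho ^+ 2 by rewrite exprn_gt0// (offspring_rho_gt0 hmu).
(* Up to [1 / rho ^+ 2] the bound of [hitfun_ge] is at least [t / 2]; monotonicity covers larger
   arguments. *)
pose t := Num.min s (rho ^+ 2)^-1.
have t0 : 0 < t by rewrite lt_min s0 invr_gt0.
have ts : t <= s by rewrite ge_min lexx.
have tr : rho ^+ 2 * t <= 1.
  by rewrite -ler_pdivlMl// mulr1 ge_min lexx orbT.
apply: lt_le_trans (hitfun_le (ltW t0) ts s1).
apply: lt_le_trans (hitfun_ge _); last by rewrite ltW//= (le_trans ts).
by rewrite expr2; nra.
Qed.

End offspring_functional.

(** * Unordered sums and integrals against discrete laws *)

Lemma esumZl {R : realType} {T : choiceType} (D : set T) (c : R)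
  (a : T -> \bar R) : 0 <= c -> (forall i, (0 <= a i)%E) ->
  (\esum_(i in D) (c%:E * a i) = c%:E * \esum_(i in D) a i)%E.
Proof.
have half (c' : R) (b : T -> \bar R) : 0 <= c' -> (forall i, (0 <= b i)%E) ->
    (\esum_(i in D) (c'%:E * b i) <= c'%:E * \esum_(i in D) b i)%E.
  move=> c0 b0; apply: ge_ereal_sup => _ [X [finX XD] <-].
  rewrite -ge0_mule_fsumr//; apply: lee_wpmul2l; first by rewrite lee_fin.
  by apply: esum_ge; exists X.
(* The reverse inequality is [half] for [c^-1] and the family [c * a]. *)
move=> c0 a0; apply/le_anti; rewrite half//=.
have [->|cn0] := eqVneq c 0.
  by rewrite mul0e; apply: esum_ge0 => i _; rewrite mul0e.
have ci : 0 <= c^-1 by rewrite invr_ge0.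
have ca i : (0 <= c%:E * a i)%E by rewrite mule_ge0// lee_fin.
have := half _ _ ci ca; under eq_esum do rewrite muleA -EFinM mulVf// mul1e.
move/(lee_wpmul2l (x := c%:E)); rewrite lee_fin => /(_ c0).
by rewrite muleA -EFinM mulfV// mul1e.
Qed.

Section discrete_integral.
Context {disp : measure_display} {T : measurableType disp} {R : realType}.
Hypothesis mT : forall A : set T, measurable A.
Variable P : probability T R.
Variable e : T -> nat.
Hypothesis e_inj : injective e.

(** The fibres of [e] are empty or single points, and both sides are countably additive over
    them. *)
Lemma integral_discrete (f : T -> R) : (forall x, 0 <= f x) ->
  (\int[P]_x (f x)%:E = \esum_(x in setT) (f x * fine (P [set x]))%:E)%E.
Proof.
move=> f0; pose F n := e @^-1` [set n].
have FT : \bigcup_n F n = setT by apply/seteqP; split=> // x _; exists (e x).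
have tF : trivIset setT F by move=> i j _ _ [x [/= <- <-]].
rewrite -FT ge0_integral_bigcup//; last by move=> x _; rewrite lee_fin.
rewrite esum_bigcupT//; last first.
  by move=> x; rewrite lee_fin mulr_ge0// fine_ge0.
rewrite nneseries_esumT; last first.
  by move=> n; apply: integral_ge0 => x _; rewrite lee_fin.
apply: eq_esum => n _.
have [[x Fx]|/forallNP noF] := pselect (exists x, F n x); last first.
  have -> : F n = set0 by apply/seteqP; split=> // x /noF.
  by rewrite integral_set0 esum_set0.
have -> : F n = [set x].
  by apply/seteqP; split=> [y /= Fy|_ ->//]; apply: e_inj; rewrite Fy Fx.
rewrite esum_set1; last by rewrite lee_fin mulr_ge0// fine_ge0.
rewrite (eq_integral (cst (f x)%:E)); last by move=> y; rewrite inE => ->.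
rewrite integral_cst// EFinM fineK// fin_num_measure//.
Qed.

Lemma atom_le_E (f : T -> R) y : (forall x, 0 <= f x) ->
  P.-integrable setT (EFin \o f) ->
  f y * fine (P [set y]) <= \int[P]_x f x.
Proof.
move=> f0 igf; rewrite -lee_fin /Rintegral fineK; last exact: integrable_fin_num.
rewrite integral_discrete//.
by apply: esum_ge; exists [set y] => //; rewrite fsbig_set1.
Qed.

End discrete_integral.

Lemma Zd_measurable d (A : set (Zd d)) : measurable A.
Proof. by []. Qed.

(** * The comparison principle *)

Section comparison.
Context {R : realType} {d : nat}.
Variables (mu : probability nat R) (theta : probability (Zd d) R).
Hypothesis hmu : offspring_assumptions mu.

Local Notation G := (hitfun mu).
Local Notation P f x := (\int[theta]_y (f (x - y))).

Lemma ig_in01 (f : Zd d -> R) : (forall x, 0 <= f x <= 1) ->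
  theta.-integrable setT (EFin \o f).
Proof.
move=> f01; apply: (@ig_bounded _ _ _ (@Zd_measurable d) theta 1) => x.
by have /andP[f0 f1] := f01 x; rewrite ger0_norm.
Qed.

(* With s the supremum of v - u, subadditivity of G gives
   v <= G (P v) <= G (P u + s) <= u + G s, so s <= G s, which forces s = 0. *)
Lemma comparison (u v : Zd d -> R) :
  (forall x, 0 <= u x <= 1) -> (forall x, 0 <= v x <= 1) ->
  (forall x, v x <= u x \/ (v x <= G (P v x) /\ G (P u x) <= u x)) ->
  forall x, v x <= u x.
Proof.
move=> u01 v01 H.
have u01' x : forall y, 0 <= u (x - y) <= 1 by [].
have v01' x : forall y, 0 <= v (x - y) <= 1 by [].
have iu x : theta.-integrable setT (EFin \o (fun y => u (x - y))).
  exact: ig_in01.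
have iv x : theta.-integrable setT (EFin \o (fun y => v (x - y))).
  exact: ig_in01.
have Pu01 x : 0 <= P u x <= 1 by apply: (E_in01 (@Zd_measurable d)).
have Pv01 x : 0 <= P v x <= 1 by apply: (E_in01 (@Zd_measurable d)).
pose D := [set v x - u x | x in setT].
have Dsup : has_sup D.
  split; first by exists (v 0 - u 0), 0.
  exists 1 => _ [x _ <-]; have := u01 x; have := v01 x; lra.
set s := sup D.
have vs x : v x - u x <= s by apply: ub_le_sup; [case: Dsup|exists x].
have s1 : s <= 1.
  apply: ge_sup; first by case: Dsup.
  by move=> _ [x _ <-]; have := u01 x; have := v01 x; lra.
have [s0|s0] := leP s 0.
  by move=> x; have := vs x; lra.
have s01 : 0 <= s <= 1 by rewrite ltW.
(* Needed at the points where [v x <= u x], whose contribution to the supremum is at most 0. *)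
have Gs0 : 0 <= G s by apply: ltW; apply: hitfun_gt0 => //; rewrite s0.
suff : s <= G s by move=> /(hitfun_ge_id_eq0 hmu s01) s00; rewrite s00 ltxx in s0.
apply: ge_sup; first by case: Dsup.
move=> _ [x _ <-].
case: (H x) => [|[vG Gu]]; first lra.
have /andP[Pu0 Pu1] := Pu01 x; have /andP[Pv0 Pv1] := Pv01 x.
have Pvs : P v x <= P u x + s.
  have e : P u x + s = \int[theta]_y (u (x - y) + cst s y).
    by rewrite ED ?Ecst//; exact: (ig_cst theta s).
  rewrite e; apply: E_le => //; first exact: (igD (iu x) (ig_cst theta s)).
  by move=> y /=; have := vs (x - y); lra.
have [le|lt] := leP (P v x) (P u x).
  have := hitfun_le hmu Pv0 le Pu1; lra.
have b0 : 0 <= P v x - P u x by lra.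
have := hitfun_subadd hmu Pu0 b0; rewrite addrC subrK => /(_ Pv1).
have := hitfun_le hmu b0 _ s1; move=> /(_ ltac:(lra)).
lra.
Qed.

End comparison.

(** * The equation of the hitting probabilities *)

Section tree_weights.
Context {R : realType} {d : nat}.
Variables (mu : probability nat R) (theta : probability (Zd d) R).
Local Notation tree := (spatial_tree d).
Implicit Types (t : tree) (s : seq tree) (B : set tree).

Let p k : R := fine (mu [set k]).
Let q x : R := fine (theta [set x]).

Definition subtrees t := let: SNode _ s := t in s.

(** The set operator of the branching recursion; the root itself is unconstrained. The set of all
    trees is a fixed point, the height bounds are iterates, and the trees avoiding [a] agree with
    their image among trees not rooted at [a]. *)
Definition grow B : set tree := [set t | forall t', t' \in subtrees t -> B t'].

(* [spatial_weight] without the constraint on the position of the root. *)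
Definition weight t : R :=
  \prod_(k <- offspring t) p k * \prod_(x <- increments t) q x.

Lemma weight_ge0 t : 0 <= weight t.
Proof.
by rewrite /weight mulr_ge0//; elim/big_ind: _ => //= *; rewrite ?mulr_ge0 ?fine_ge0.
Qed.

Lemma weight_node x s :
  weight (SNode x s) = p (size s) * \prod_(t <- s) (q (root_pos t - x) * weight t).
Proof.
rewrite /weight /= big_cons -mulrA; congr (_ * _).
elim: s => [|t s IH] /=; first by rewrite !big_nil mulr1.
by rewrite [RHS]big_cons -IH big_cons !big_cat mulrCA mulrACA mulrA.
Qed.

(** Distributivity: the head and the tail of the list range independently, which gives one factor
    [c] per entry. *)
Lemma esum_size B (g : tree -> R) c k : (forall t, 0 <= g t) ->
  (\esum_(t in B) (g t)%:E = c%:E)%E ->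
  (\esum_(s in [set s | size s = k /\ forall t, t \in s -> B t])
     (\prod_(t <- s) g t)%:E = (c ^+ k)%:E)%E.
Proof.
move=> g0 gc; have c0 : 0 <= c.
  by rewrite -lee_fin -gc; apply: esum_ge0 => t _; rewrite lee_fin.
have pg0 s : 0 <= \prod_(t <- s) g t by elim/big_ind: _ => //= *; rewrite mulr_ge0.
elim: k => [|k IH].
  have -> : [set s | size s = 0 /\ forall t, t \in s -> B t] = [set [::]].
    by apply/seteqP; split=> [[|t s] []//|_ ->].
  by rewrite esum_set1 big_nil ?expr0// lee_fin.
set A := [set s | size s = k /\ _] in IH.
rewrite (reindex_esum (B `*`` (fun=> A)) _ (fun ts => ts.1 :: ts.2)); last first.
  split.
  - move=> [t s] /= [Bt [<- Bs]]; split=> // t'.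
    by rewrite inE => /predU1P[->//|]; exact: Bs.
  - by move=> [t s] [t' s'] /= _ _ [-> ->].
  - move=> [|t s] [//= [ks] Bs]; exists (t, s) => //=; split.
      by apply: Bs; rewrite inE eqxx.
    by split=> // t' t's; apply: Bs; rewrite inE t's orbT.
under eq_esum do rewrite big_cons EFinM.
rewrite -(@esum_esum _ _ _ B (fun=> A) (fun t s => (g t)%:E * (\prod_(t <- s) g t)%:E)%E); last first.
  by move=> t s _ _; rewrite -EFinM lee_fin mulr_ge0.
under eq_esum => t _.
  rewrite esumZl// IH muleC; over.
by rewrite esumZl ?exprn_ge0// gc -EFinM exprSr.
Qed.

Definition mass B x := (\esum_(t in [set t | B t /\ root_pos t = x]) (weight t)%:E)%E.

Lemma mass_ge0 B x : (0 <= mass B x)%E.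
Proof. by apply: esum_ge0 => t _; rewrite lee_fin weight_ge0. Qed.

Lemma subset_mass B B' x : (forall t, root_pos t = x -> B t -> B' t) ->
  (mass B x <= mass B' x)%E.
Proof.
move=> BB'; rewrite /mass esum_mkcond [leRHS]esum_mkcond; apply: le_esum => t _.
case: ifPn => [|_]; last by case: ifPn => // _; rewrite lee_fin weight_ge0.
rewrite inE => -[Bt tx].
by rewrite ifT// inE; split => //; exact: BB'.
Qed.

(** This is the branching property: given [k] children, their subtrees are independent, and each is
    rooted at [x] plus a jump. *)
Lemma mass_grow B f x : (forall y, 0 <= f y <= 1) ->
  (forall y, mass B y = (f y)%:E) ->
  mass (grow B) x = (\int[mu]_k (\int[theta]_y f (x + y)) ^+ k)%:E.
Proof.
move=> f01 Bf.
have f0 y : 0 <= f y by case/andP: (f01 y).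
have q0 y : 0 <= q y by rewrite fine_ge0.
pose g t := q (root_pos t - x) * weight t.
have g0 t : 0 <= g t by rewrite mulr_ge0// weight_ge0.
have Pf01 : 0 <= \int[theta]_y f (x + y) <= 1.
  by apply: (E_in01 (@Zd_measurable d)).
have [Pf0 Pf1] := andP Pf01.
have Eg : (\esum_(t in B) (g t)%:E = (\int[theta]_y f (x + y))%:E)%E.
  have igf : theta.-integrable setT (EFin \o (fun y => f (x + y))).
    by apply: ig_in01.
  rewrite /Rintegral fineK; last exact: integrable_fin_num.
  rewrite (@integral_discrete _ _ _ (@Zd_measurable d) theta pickle
    (pcan_inj (@pickleK _))); last by [].
  rewrite (reindex_esum [set: Zd d] _ (fun y => y - x)
    (fun y => (f (x + y) * fine (theta [set y]))%:E)); last first.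
    split=> // [y y' _ _ /addIr//|y _]; by exists (y + x) => //; rewrite addrK.
  under [RHS]eq_esum => y _.
    rewrite addrC subrK mulrC EFinM -Bf /mass -esumZl ?fine_ge0//; last first.
      by move=> t; rewrite lee_fin weight_ge0.
    over.
  rewrite (@esum_esum _ _ _ setT (fun y => [set t | B t /\ root_pos t = y])
    (fun y t => ((q (y - x))%:E * (weight t)%:E)%E)); last first.
    by move=> y t _ _; rewrite -EFinM lee_fin mulr_ge0 ?weight_ge0.
  (* A tree determines the position of its root, so the pairs (position, tree) are indexed by the
     tree alone. *)
  rewrite (reindex_esum B _ (fun t => (root_pos t, t))).
    by apply: eq_esum.
  split=> // [t t' _ _ []//|[y t] [_ [/= Bt <-]]]; by exists t.
rewrite /mass.
rewrite (reindex_esum [set s : seq tree | forall t, t \in s -> B t] _ (fun s => SNode x s));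
  last first.
  split=> [s //|s s' _ _ []//|[y s] [/= Bs <-]]; by exists s.
under eq_esum do rewrite weight_node.
rewrite (_ : [set s | _] = \bigcup_k [set s | size s = k /\ forall t, t \in s -> B t]);
  last first.
  by apply/seteqP; split=> [s Bs|s [k _ [_ //]]]; exists (size s).
have pg0 s : 0 <= \prod_(t <- s) g t by elim/big_ind: _ => //= *; rewrite mulr_ge0.
rewrite esum_bigcupT; last 2 first.
- by move=> i j _ _ [s [[<- _] [<- _]]].
- by move=> s; rewrite lee_fin mulr_ge0 ?fine_ge0.
rewrite /Rintegral fineK; last first.
  apply: integrable_fin_num => //; apply: (@ig_bounded _ _ _ nat_measurable mu 1).
  by move=> k; rewrite ger0_norm ?exprn_ge0// exprn_ile1.
rewrite (@integral_discrete _ _ _ nat_measurable mu id (fun _ _ e => e)); last first.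
  by move=> k; rewrite exprn_ge0.
apply: eq_esum => k _; rewrite mulrC EFinM -(esum_size k g0 Eg) -esumZl ?fine_ge0//.
by apply: eq_esum => s [<- _]; rewrite EFinM.
Qed.

End tree_weights.

Section hitting_probability.
Context {R : realType} {d : nat}.
Variables (mu : probability nat R) (theta : probability (Zd d) R).
Hypothesis hmu : offspring_assumptions mu.
Local Notation tree := (spatial_tree d).
Local Notation mass := (mass mu theta).
Local Notation G := (hitfun mu).

Fixpoint height (t : tree) : nat :=
  let: SNode _ s := t in (foldr maxn 0 (map height s)).+1.

Lemma height_grow n :
  [set t : tree | (height t <= n.+1)%N] = grow [set t | (height t <= n)%N].
Proof.
apply/seteqP; split=> -[x s] /=; rewrite ltnS.
  elim: s => [//|t s IH] /=; rewrite geq_max => /andP[tn sn] t'.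
  by rewrite inE => /predU1P[->//|]; exact: IH.
elim: s => [//|t s IH] /= H; rewrite geq_max IH ?andbT.
  by apply: H; rewrite inE eqxx.
by move=> t' t's; apply: H; rewrite inE t's orbT.
Qed.

(** Heights start at 1, so [n = 0] gives the empty set and [h = 0]. Each further level applies the
    generating function to [h]; the jumps only average a constant, hence no dependence on [x]. *)
Lemma mass_height n : exists2 h : R, 0 <= h <= 1 &
  forall x, mass [set t | (height t <= n)%N] x = h%:E.
Proof.
elim: n => [|n [h h01 Hh]].
  exists 0 => [|x]; first by rewrite lexx ler01.
  by apply: esum1 => -[y s] [].
have [h0 h1] := andP h01.
exists (\int[mu]_k (h ^+ k)) => [|x].
  apply: (E_in01 nat_measurable) => k.
  by rewrite exprn_ge0// exprn_ile1.
rewrite height_grow (@mass_grow _ _ mu theta _ (fun=> h))//.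
by congr EFin; apply: eq_Rintegral => k _; rewrite [X in X ^+ k]Ecst.
Qed.

(** Finitely many trees have bounded height, so every finite partial sum is below some [h <= 1].
    This a priori bound allows masses to be handled as real numbers. *)
Lemma mass_le1 B x : (mass B x <= 1)%E.
Proof.
apply: (@le_trans _ _ (mass setT x)); first exact: subset_mass.
apply: ge_ereal_sup => _ [X [finX Xx] <-].
have /finite_seqP[r Xr] := finX; pose n := (\max_(t <- r) height t)%N.
have Xn t : X t -> (height t <= n)%N.
  by rewrite Xr /= => tr; exact: leq_bigmax_seq.
have [h /andP[_ h1] Hh] := mass_height n.
apply: (@le_trans _ _ (mass [set t | (height t <= n)%N] x)).
  apply: esum_ge; exists X => //; split=> // t Xt; split; first exact: Xn.
  by have [] := Xx _ Xt.
by rewrite Hh lee_fin.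
Qed.

Lemma massE B x : mass B x = (fine (mass B x))%:E.
Proof.
rewrite fineK// ge0_fin_numE ?mass_ge0//.
exact: le_lt_trans (mass_le1 B x) (ltry _).
Qed.

Lemma mass01 B x : 0 <= fine (mass B x) <= 1.
Proof. by rewrite -!lee_fin -massE mass_ge0 mass_le1. Qed.

Lemma mass_fixpoint B x : fine (mass (grow B) x) =
  1 - G (\int[theta]_y (1 - fine (mass B (x + y)))).
Proof.
have i01 y : 0 <= fine (mass B (x + y)) <= 1 := mass01 B (x + y).
rewrite (@mass_grow _ _ mu theta B (fun y => fine (mass B y))) /=; last 2 first.
- exact: mass01.
- by move=> y; exact: massE.
rewrite (@EB _ _ _ theta (cst 1)) ?Ecst; last 2 first.
- exact: (ig_cst theta 1).
- exact: ig_in01.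
have m01 := E_in01 (@Zd_measurable d) theta i01.
rewrite hitfunE//; last by lra.
by rewrite opprB addrC subrK; apply: eq_Rintegral => k _; rewrite opprB addrC subrK.
Qed.

(** Almost sure extinction, by comparison: the missing mass [e] solves the equation at every point,
    without boundary condition, and so does 0. *)
Lemma mass_total x : fine (mass setT x) = 1.
Proof.
(* The sign reconciles [mass_fixpoint], which averages over [x + y], with [comparison], which
   averages over [z - y]. *)
pose e z := 1 - fine (mass setT (- z)).
have e01 z : 0 <= e z <= 1 by rewrite /e; have := mass01 setT (- z); lra.
have He z : e z = G (\int[theta]_y e (z - y)).
  rewrite /e -[in LHS](_ : grow setT = setT); last by apply/seteqP; split.
  rewrite mass_fixpoint opprB addrC subrK; congr G.
  by apply: eq_Rintegral => y _; rewrite opprB [- z + y]addrC.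
have e0 : e (- x) <= 0.
  apply: (comparison (mu := mu) (theta := theta) hmu (u := fun=> 0)) => //.
  by move=> z; rewrite lexx ler01.
  move=> z; right; rewrite -He lexx; split => //.
  by rewrite [X in G X]Ecst hitfun0.
by have := mass01 setT x; move: e0; rewrite /e opprK; lra.
Qed.

Definition avoiding a : set tree := [set t | ~ visited t a].

Lemma visited_node (x a : Zd d) s : visited (SNode x s) a <->
  a = x \/ exists2 t, t \in s & visited t a.
Proof.
rewrite /visited /= inE; split.
  case/predU1P => [->|/flatten_mapP[t ts ta]]; first by left.
  by right; exists t.
case=> [->|[t ts ta]]; first by rewrite eqxx.
by apply/orP; right; apply/flatten_mapP; exists t.
Qed.

Lemma mass_avoiding_self a : mass (avoiding a) a = 0%E.
Proof.
apply: esum1 => -[y s] [/= H ya]; exfalso; apply: H.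
by apply/visited_node; left.
Qed.

Lemma mass_avoiding a x : x != a -> mass (avoiding a) x = mass (grow (avoiding a)) x.
Proof.
move=> xa; apply/le_anti/andP; split; apply: subset_mass => -[y s] /= yx.
  by move=> H t ts ta; apply: H; apply/visited_node; right; exists t.
move=> H /visited_node[ay|[t ts ta]]; last exact: (H t ts).
by rewrite -yx ay eqxx in xa.
Qed.

Lemma Pi_star_visited a :
  fine (Pi_star mu theta [set t | visited t a]) = 1 - fine (mass (avoiding a) 0).
Proof.
pose root0 : set tree := [set t | root_pos t = 0].
have -> : Pi_star mu theta [set t | visited t a] =
    (\esum_(t in root0 `&` [set t | visited t a]) (weight mu theta t)%:E)%E.
  rewrite /Pi_star esum_mkcondl; apply: eq_esum => t _.
  rewrite /spatial_weight; case: ifPn => [|/negP].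
    by rewrite inE /= => ->; rewrite eqxx mul1r.
  by rewrite inE /= => /eqP/negPf ->; rewrite mul0r mulr0.
have w0 t : (0 <= (weight mu theta t)%:E)%E by rewrite lee_fin weight_ge0.
have := esumID [set t : tree | visited t a] root0
  (fun t => (weight mu theta t)%:E) (fun t _ => w0 t).
have -> : root0 `&` ~` [set t | visited t a] =
    [set t | avoiding a t /\ root_pos t = 0].
  by apply/seteqP; split=> t [].
have -> : (\esum_(t in root0) (weight mu theta t)%:E = 1)%E.
  rewrite -[1%E]/(1%:E) -(mass_total 0) -massE /mass; congr esum.
  by apply/seteqP; split=> t; [|case].
rewrite -[X in (_ = _ + X)%E]/(mass (avoiding a) 0) massE.
by case: (\esum_(_ in _) _)%E => //= r [->]; rewrite addrK.
Qed.

(** In the proof, [v a z] is the probability of reaching [a] from [a - z]. All the [v a] solve one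
    equation with value 1 at 0, so comparison in both directions identifies them; no translation of
    trees is required. *)
Lemma hitting_equation : exists v : Zd d -> R,
  [/\ forall z, 0 <= v z <= 1, v 0 = 1,
      forall z, z != 0 -> v z = G (\int[theta]_y v (z - y)) &
      forall a, fine (Pi_star mu theta [set t | visited t a]) = v a].
Proof.
pose v a z := 1 - fine (mass (avoiding a) (a - z)).
have v01 a z : 0 <= v a z <= 1 by rewrite /v; have := mass01 (avoiding a) (a - z); lra.
have v0 a : v a 0 = 1 by rewrite /v subr0 mass_avoiding_self subr0.
have Hv a z : z != 0 -> v a z = G (\int[theta]_y v a (z - y)).
  move=> z0; rewrite /v mass_avoiding; last by rewrite -subr_eq0 addrAC subrr sub0r oppr_eq0.
  rewrite mass_fixpoint opprB addrC subrK; congr G.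
  by apply: eq_Rintegral => y _; rewrite opprB addrAC addrA.
have vle a b z : v a z <= v b z.
  apply: (comparison (mu := mu) (theta := theta) hmu (u := v b) (v := v a)) => // x.
  have [->|x0] := eqVneq x 0; first by left; rewrite !v0.
  by right; rewrite -!Hv// !lexx.
exists (v 0); split=> // a; first exact: Hv.
transitivity (v a a); first by rewrite Pi_star_visited /v subrr.
by apply/le_anti; rewrite !vle.
Qed.

End hitting_probability.

(** * Radial barriers *)

Section fourth_root_expansions.
Context {R : realFieldType}.
Variables s r : R.
Hypotheses (s0 : 0 < s) (s4 : s ^+ 4 = 1 + r) (r12 : `|r| <= 2^-1).

Let rE : r = (s - 1) * ((s + 1) * (s ^+ 2 + 1)).
Proof. have -> : r = s ^+ 4 - 1 by rewrite s4; ring. ring. Qed.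

Let r_le : - 2^-1 <= r <= 2^-1.
Proof. by rewrite -ler_norml. Qed.

Let s_le : s <= 9 / 8.
Proof.
rewrite leNgt; apply/negP => s98.
have : (9 / 8) ^+ 4 < s ^+ 4 by rewrite ltrXn2r.
by rewrite s4; have := r_le; lra.
Qed.

Let s_ge : 2^-1 <= s.
Proof.
rewrite leNgt; apply/negP => s12.
have : s ^+ 4 < 2^-1 ^+ 4 by rewrite ltrXn2r// ltW.
by rewrite s4; have := r_le; lra.
Qed.

Let pow_le k : (k <= 10)%N -> 0 <= s ^+ k <= 4.
Proof.
move=> k10; rewrite (exprn_ge0 _ (ltW s0))/=.
apply: (@le_trans _ _ ((9 / 8) ^+ k)); first by rewrite lerXn2r ?nnegrE// ltW.
apply: (@le_trans _ _ ((9 / 8) ^+ 10)); last by lra.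
by rewrite ler_weXn2l//; lra.
Qed.

Let cube_le : `|s - 1| ^+ 3 <= `|r| ^+ 3.
Proof.
rewrite lerXn2r ?nnegrE// rE normrM ler_peMr//.
by rewrite ger0_norm; have := s0; nra.
Qed.

Let cube_bound (c Q : R) : 0 <= Q <= c -> `|(s - 1) ^+ 3 * Q| <= c * `|r| ^+ 3.
Proof.
case/andP=> Q0 Qc; rewrite normrM normrX mulrC (ger0_norm Q0).
by apply: ler_pM => //; rewrite exprn_ge0.
Qed.

Lemma inv_le : s ^- 4 <= 1 - r + r ^+ 2 + 2 * `|r| ^+ 3.
Proof.
rewrite s4; have := r_le => /andP[r1 r2].
have r3 : - r ^+ 3 <= `|r| ^+ 3.
  by rewrite -normrX -normrN; exact: ler_norm.
have p0 : 0 < 1 + r by lra.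
rewrite -div1r ler_pdivrMr// mulrC -subr_ge0.
have -> : (1 + r) * (1 - r + r ^+ 2 + 2 * `|r| ^+ 3) - 1 =
  r ^+ 3 + `|r| ^+ 3 + (2 * r + 1) * `|r| ^+ 3 by ring.
have : 0 <= `|r| ^+ 3 by rewrite exprn_ge0.
by nra.
Qed.

(** The quadratic is the Taylor polynomial of [(1 + r) ^ (-5/4)]. Its product with [s ^+ 5] equals 1
    up to third order at [s = 1], with an explicit cofactor [Q], and [s - 1] is at most [r] in
    absolute value. *)
Lemma pow5_inv_le :
  s ^- 5 <= 1 - 5 / 4 * r + 45 / 32 * r ^+ 2 + 1600 * `|r| ^+ 3.
Proof.
have s5 : 0 < s ^+ 5 by rewrite exprn_gt0.
have s5_ge : 4^-1 <= s ^+ 5.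
  rewrite exprSr s4; have := r_le => /andP[r1 r2].
  by apply: (@le_trans _ _ (2^-1 * 2^-1)); [lra | apply: ler_pM; have := s_ge; lra].
rewrite -div1r ler_pdivrMr// mulrC.
pose Q := 1 + 3 * s + 6 * s ^+ 2 + 10 * s ^+ 3 + 15 * s ^+ 4 + 555 / 32 * s ^+ 5
  + 545 / 32 * s ^+ 6 + 225 / 16 * s ^+ 7 + 135 / 16 * s ^+ 8
  + 135 / 32 * s ^+ 9 + 45 / 32 * s ^+ 10.
have E : s ^+ 5 * (1 - 5 / 4 * r + 45 / 32 * r ^+ 2) = 1 + (s - 1) ^+ 3 * Q.
  by rewrite rE /Q; field.
(* Powers of [s] are at most 4 and the coefficients of [Q] sum to less than 100. Dividing by
   [s ^+ 5 >= 1 / 4] turns 400 into 1600. *)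
have Qb : 0 <= Q <= 400.
  have := pow_le (k := 1) isT; have := pow_le (k := 2) isT.
  have := pow_le (k := 3) isT; have := pow_le (k := 4) isT.
  have := pow_le (k := 5) isT; have := pow_le (k := 6) isT.
  have := pow_le (k := 7) isT; have := pow_le (k := 8) isT.
  have := pow_le (k := 9) isT; have := pow_le (k := 10) isT.
  by rewrite /Q; lra.
have /ler_normlP[b _] := cube_bound Qb.
rewrite mulrDr E.
have : 0 <= `|r| ^+ 3 by rewrite exprn_ge0.
move: b; move: (_ * Q) (`|r| ^+ 3) => p c b c0.
by nra.
Qed.

Lemma pow3_le : s ^+ 3 <= 1 + 3 / 4 * r - 3 / 32 * r ^+ 2 + 10 * `|r| ^+ 3.
Proof.
pose Q := 5 / 32 + 15 / 32 * s + 15 / 16 * s ^+ 2 + 9 / 16 * s ^+ 3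
  + 9 / 32 * s ^+ 4 + 3 / 32 * s ^+ 5.
have E : 1 + 3 / 4 * r - 3 / 32 * r ^+ 2 = s ^+ 3 - (s - 1) ^+ 3 * Q.
  by rewrite rE /Q; field.
have Qb : 0 <= Q <= 10.
  have := pow_le (k := 1) isT; have := pow_le (k := 2) isT.
  have := pow_le (k := 3) isT; have := pow_le (k := 4) isT.
  have := pow_le (k := 5) isT.
  by rewrite /Q; lra.
have /ler_normlP[_ b] := cube_bound Qb.
by rewrite E; lra.
Qed.

(** With [g = N + K * N ^ (3/4)] and [z = N x / g x], the right-hand side is [g x / g (x - y)]. The
    constant 50 is uniform in [z], hence in [K], which is chosen only after the error terms are
    fixed. *)
Lemma mix_inv_ge z : 0 <= z <= 1 ->
  1 - (3 + z) / 4 * r + (((3 + z) / 4) ^+ 2 + 3 / 32 * (1 - z)) * r ^+ 2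
    - 50 * `|r| ^+ 3 <= (z * s ^+ 4 + (1 - z) * s ^+ 3)^-1.
Proof.
case/andP=> z0 z1; set n1 := (3 + z) / 4; set m := n1 ^+ 2 + _.
set W := (X in X <= _); set N := z * _ + _.
have N0 : 0 < N.
  have -> : N = s ^+ 3 * (z * s + (1 - z)) by rewrite /N; ring.
  by rewrite mulr_gt0 ?exprn_gt0//; have := s0; nra.
rewrite -[leRHS]mul1r ler_pdivlMr//.
have [W0|W0] := leP W 0.
  by apply: (@le_trans _ _ 0) => //; rewrite mulr_le0_ge0// ltW.
pose n2 := - (3 / 32) * (1 - z); pose c := `|r| ^+ 3.
have c0 : 0 <= c by rewrite exprn_ge0.
have ND : N <= 1 + n1 * r + n2 * r ^+ 2 + 10 * c.
  have := ler_wpM2l (_ : 0 <= 1 - z) pow3_le; rewrite subr_ge0 => /(_ z1).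
  have : 0 <= z * c by rewrite mulr_ge0.
  by rewrite -/c /N s4 /n1 /n2; nra.
apply: (le_trans (ler_wpM2l (ltW W0) ND)).
have r_c : r ^+ 3 <= c by rewrite /c -normrX ler_norm.
have [/andP[r1 r2] n1b n2b] : [/\ - 2^-1 <= r <= 2^-1, 3 / 4 <= n1 <= 1 &
    - (3 / 32) <= n2 <= 0].
  by split; [exact: r_le|rewrite /n1; lra|rewrite /n2; lra].
have mE : m = n1 ^+ 2 - n2 by rewrite /m /n2; ring.
have mb : 0 <= m <= 9 / 8 by rewrite mE; nra.
have rr : 0 <= r ^+ 2 <= 4^-1 by rewrite sqr_ge0/= expr2; nra.
(* The terms of degree one and two cancel. The gain, at least [50 * 19 / 40 * c], exceeds the losses
   [6 / 5 * c] and [10 * 9 / 5 * c]. *)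
have -> : W * (1 + n1 * r + n2 * r ^+ 2 + 10 * c) =
    1 + n1 * (n1 ^+ 2 - 2 * n2) * r ^+ 3 + n2 * m * (r ^+ 2) ^+ 2
    + 10 * c * (1 - n1 * r + m * r ^+ 2) - 50 * c * (1 + n1 * r + n2 * r ^+ 2)
    - 500 * c ^+ 2.
  by rewrite /W -/c mE; ring.
have k1 : n1 * (n1 ^+ 2 - 2 * n2) * r ^+ 3 <= 6 / 5 * c.
  have k : 0 <= n1 * (n1 ^+ 2 - 2 * n2) <= 6 / 5.
    have : 0 <= n1 ^+ 2 - 2 * n2 <= 6 / 5 by nra.
    by nra.
  by apply: (le_trans (ler_wpM2l _ r_c)); [|apply: ler_wpM2r]; case/andP: k.
have k2 : n2 * m * (r ^+ 2) ^+ 2 <= 0.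
  by rewrite mulr_le0_ge0 ?sqr_ge0//; nra.
have k3 : 1 - n1 * r + m * r ^+ 2 <= 9 / 5 by nra.
have k4 : 19 / 40 <= 1 + n1 * r + n2 * r ^+ 2 by nra.
have k5 := ler_wpM2l c0 k3; have k6 := ler_wpM2l c0 k4.
have k7 : 0 <= c ^+ 2 by rewrite sqr_ge0.
by lra.
Qed.

End fourth_root_expansions.

(** * Inequalities between the coefficients of drift and quadratic loss *)

Section barrier_arithmetic.
Context {R : realFieldType}.
(* The expected increment of [N ^ (-k)] is close to
   [(2 * k * (k + 1) - k * D) / N ^ (k + 1)]: this gives the coefficients
   [4 - D] for [k = 1] and [45 / 8 - 5 / 4 * D] for [k = 5 / 4]. *)
Lemma supersolution_arith (e A bt H k D ep : R) :
  0 < e <= 1 -> 0 < A -> 0 <= bt -> H = A + bt -> 0 <= D <= 3 ->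
  k * A = (4 - D) * (1 + e) -> 0 < ep -> 1603 * ep <= e / 4 -> ep <= e * A / 4 ->
  let dl := (4 - D) * A + (45 / 8 - 5 / 4 * D) * bt + ep * (1603 * H + 1) in
  dl <= 8 * H /\ dl <= (k - k * e / 4) * H ^+ 2.
Proof.
move=> /andP[e0 e1] A0 b0 -> /andP[D0 D3] kA ep0 ep1 ep2 dl.
have [e1A ebt] : ep * (1603 * (A + bt)) <= e / 4 * (A + bt) /\ e * bt <= bt.
  split; last by rewrite ler_piMl.
  by rewrite mulrA [ep * _]mulrC ler_wpM2r// addr_ge0// ltW.
have eA : e * A <= A by rewrite ler_piMl// ltW.
have DA : 0 <= D * A by rewrite mulr_ge0// ltW.
have Db : 0 <= D * bt by rewrite mulr_ge0.
split; first by rewrite /dl; move: e1A ep2 ebt eA DA Db A0 b0; clear; lra.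
have k0 : 0 < k by rewrite -(pmulr_lgt0 _ A0) kA mulr_gt0//; lra.
have ke : 0 <= k - k * e / 4.
  have : k * e <= k by rewrite ler_piMr// ltW.
  by move: k0; clear; lra.
(* The square of [bt] is dropped from [H ^+ 2]; the cross term suffices. *)
apply: (@le_trans _ _ ((k - k * e / 4) * (A * (A + 2 * bt)))); last first.
  by rewrite ler_wpM2l//; have := sqr_ge0 bt; lra.
have -> : (k - k * e / 4) * (A * (A + 2 * bt)) =
    (4 - D) * ((1 + e) * (1 - e / 4)) * (A + 2 * bt).
  by rewrite (_ : _ * (A * _) = (k * A) * ((1 - e / 4) * (A + 2 * bt))); [rewrite kA; ring|ring].
have Ab : 0 <= A + 2 * bt by lra.
have e2 : 1 + e / 2 <= (1 + e) * (1 - e / 4) by nra.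
have h1 : (4 - D) * (1 + e / 2) * (A + 2 * bt) <=
    (4 - D) * ((1 + e) * (1 - e / 4)) * (A + 2 * bt).
  by rewrite ler_wpM2r// ler_wpM2l//; lra.
apply: le_trans h1.
have h2 : e / 2 * (A + 2 * bt) <= (4 - D) * (e / 2 * (A + 2 * bt)).
  rewrite ler_peMl ?mulr_ge0//; lra.
have h3 : 0 <= (19 / 8 - 3 / 4 * D) * bt by rewrite mulr_ge0//; lra.
have h4 : 0 <= e * bt by rewrite mulr_ge0// ltW.
rewrite /dl; move: h2 h3 h4 e1A ep2 ; clear; lra.
Qed.

(* With [g = N + K * N ^ (3 / 4)], the variable [z] stands for [N / g], [n1] for
   [N * g' / g], and [m] for [n1 ^+ 2 - N ^+ 2 * g'' / (2 * g)], which are the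
   coefficients of the expansion of [1 / g]. *)
Lemma subsolution_arith (e D ep z q : R) : 0 < e <= 1 -> 0 <= D <= 3 ->
  432 * ep <= 1 -> 108 * ep <= e -> 0 <= z <= 1 -> 42 <= e * q -> 1 <= q -> 0 < ep ->
  let n1 := (3 + z) / 4 in let m := n1 ^+ 2 + 3 / 32 * (1 - z) in
  let K := 4 * m - n1 * D - ep * (n1 + m + 51) in
  0 <= K /\ (4 - D) * (1 - e) * z * (1 + K / q) ^+ 2 <= K.
Proof.
move=> /andP[e0 e1] /andP[D0 D3] ep1 ep2 /andP[z0 z1] eq q1 ep0 n1 m K.
have q0 : 0 < q := lt_le_trans ltr01 q1.
have n1b : 3 / 4 <= n1 <= 1 by rewrite /n1; lra.
have mb : 0 <= m <= 2 by rewrite /m; nra.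
have E : 4 * m - n1 * D = (4 - D) * z + (1 - z) * (21 / 8 - 3 / 4 * D - z / 4).
  by rewrite /m /n1; field.
have h1 : (1 - z) / 8 <= (1 - z) * (21 / 8 - 3 / 4 * D - z / 4).
  by rewrite ler_wpM2l//; lra.
(* [54 = 1 + 2 + 51] by the bounds on [n1] and [m]; 51 is the 50 of [mix_inv_ge] plus 1 for the
   large jumps. *)
have h2 : ep * (n1 + m + 51) <= ep * 54 by rewrite ler_wpM2l//; lra.
have Klo : (4 - D) * z + (1 - z) / 8 - 54 * ep <= K by rewrite /K E; lra.
have Dz : z <= (4 - D) * z by rewrite ler_peMl//; lra.
have K0 : 0 <= K by lra.
have K8 : K <= 8.
  have : 0 <= ep * (n1 + m + 51) by rewrite mulr_ge0//; lra.
  have : 0 <= n1 * D by rewrite mulr_ge0//; lra.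
  by rewrite /K; lra.
split=> //.
have x0 : 0 <= K / q by rewrite divr_ge0// ltW.
have xe : 5 * (K / q) <= e.
  by rewrite mulrA ler_pdivrMr//; lra.
have h3 : (1 - e) * (1 + K / q) ^+ 2 <= 1 - e / 2.
  by move: x0 xe e0 e1; move: (K / q) => x; clear; nra.
have h4 : (4 - D) * z * ((1 - e) * (1 + K / q) ^+ 2) <= (4 - D) * z * (1 - e / 2).
  by rewrite ler_wpM2l//; lra.
have h5 : e * z <= e * ((4 - D) * z) by rewrite ler_wpM2l// ltW.
(* Both sides are affine in [z]: the end [z = 0] asks for [432 * ep <= 1], the end [z = 1] for
   [108 * ep <= e]. *)
have h6 : 54 * ep <= (1 - z) / 8 + e * z / 2.
  have : 0 <= (1 - 432 * ep) * (1 - z).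
    by apply: mulr_ge0; [move: ep1|move: z1]; clear; lra.
  have : 0 <= (e - 108 * ep) * z by rewrite mulr_ge0// subr_ge0.
  by clear; nra.
by move: h4 h5 h6 Klo; nra.
Qed.

Lemma expansion_coefficients (a b : R) : 0 <= a -> 0 <= b ->
  `|- a - 5 / 4 * b| + `|a + 45 / 32 * b| + (2 * a + 1600 * b) <= 1603 * (a + b).
Proof.
move=> a0 b0; rewrite -opprD normrN ger0_norm; last by lra.
by rewrite ger0_norm; lra.
Qed.

Lemma supersolution_increment (A b q D ep M : R) : 0 < q -> 0 <= A -> 0 <= b ->
  0 <= ep -> M <= 1603 * (A / q + b) ->
  ((- (A / q) - 5 / 4 * b) * D + 4 * (A / q + 45 / 32 * b) + ep * M) / q
    + 1 * ep / q ^+ 2 <=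
  ((4 - D) * A + (45 / 8 - 5 / 4 * D) * (b * q) + ep * (1603 * (A + b * q) + 1))
    / q ^+ 2.
Proof.
move=> q0 A0 b0 ep0 HM.
have -> : ((4 - D) * A + (45 / 8 - 5 / 4 * D) * (b * q)
      + ep * (1603 * (A + b * q) + 1)) / q ^+ 2 =
    ((- (A / q) - 5 / 4 * b) * D + 4 * (A / q + 45 / 32 * b)
      + ep * (1603 * (A / q + b))) / q + 1 * ep / q ^+ 2.
  by field; exact: lt0r_neq0.
by rewrite lerD2r ler_wpM2r ?invr_ge0 ?(ltW q0)// lerD2l ler_wpM2l.
Qed.

End barrier_arithmetic.

(** * From moment bounds for one step to the two barriers *)

Section radial_barriers.
Context {R : realType} {d : nat}.
Variables (mu : probability nat R) (theta : probability (Zd d) R).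
Hypothesis hmu : offspring_assumptions mu.
Variables (N : Zd d -> R) (D : R).

Local Notation G := (hitfun mu).
Local Notation rho := (rho mu).

Definition relinc (x y : Zd d) : R := (N (x - y) - N x) / N x.
Local Notation r := relinc.

(* [chi] is the indicator of the increments that are small compared with [x];
   for the squared distance [N] of a normalised walk in dimension [D] the first
   two bounds express that a step increases [N x] by [D] on average, with
   variance [4 * N x]. *)
Definition increment_bounds (e : R) (x : Zd d) : Prop :=
  exists chi : Zd d -> R,
    [/\ forall y, chi y = 0 \/ (chi y = 1 /\ `|r x y| <= 2^-1),
        `|N x * \int[theta]_y (chi y * r x y) - D| <= e,
        `|N x * \int[theta]_y (chi y * r x y ^+ 2) - 4| <= e,
        N x * \int[theta]_y (chi y * `|r x y| ^+ 3) <= e &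
        N x ^+ 2 * \int[theta]_y (1 - chi y) <= e].

(** Where [chi] is 1 the expansion is integrated term by term; elsewhere the crude bound [c0 + b] is
    used, on an event of probability at most [e / N x ^+ 2]. *)
Lemma expectation_le e x (f : Zd d -> R) c0 c1 c2 c3 b :
  increment_bounds e x -> 1 <= N x -> (forall y, `|f y| <= 1) ->
  0 <= c3 -> 0 <= b ->
  (forall y, `|r x y| <= 2^-1 ->
     f (x - y) <= c0 + c1 * r x y + c2 * r x y ^+ 2 + c3 * `|r x y| ^+ 3) ->
  (forall y, f y <= c0 + b) ->
  \int[theta]_y f (x - y) <=
    c0 + (c1 * D + 4 * c2 + e * (`|c1| + `|c2| + c3)) / N x + b * e / N x ^+ 2.
Proof.
move=> [chi [chi01 m1 m2 m3 m4]] N1 f1 c30 b0 Hf fb.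
have q0 : 0 < N x := lt_le_trans ltr01 N1.
have chi_le y : 0 <= 1 - chi y <= 1.
  by case: (chi01 y) => [->|[-> _]]; rewrite ?subrr ?subr0 lexx ler01.
have chir y k : `|chi y * r x y ^+ k| <= 1.
  case: (chi01 y) => [->|[-> ry]]; first by rewrite mul0r normr0.
  rewrite mul1r normrX exprn_ile1//; apply: (le_trans ry).
  by rewrite invf_le1// ler1n.
have bnd (g : Zd d -> R) : (forall y, `|g y| <= 1) ->
    theta.-integrable setT (EFin \o g).
  by move=> H; apply: (@ig_bounded _ _ _ (@Zd_measurable d) theta 1).
have i1 : theta.-integrable setT (EFin \o (fun y => chi y * r x y)).
  by apply: bnd => y; have := chir y 1%N; rewrite expr1.
have i2 : theta.-integrable setT (EFin \o (fun y => chi y * r x y ^+ 2)).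
  by apply: bnd => y; exact: chir.
have i3 : theta.-integrable setT (EFin \o (fun y => chi y * `|r x y| ^+ 3)).
  by apply: bnd => y; rewrite normrM -normrX normr_id -normrM chir.
have i4 : theta.-integrable setT (EFin \o (fun y => 1 - chi y)).
  by apply: bnd => y; have /andP[h0 h1] := chi_le y; rewrite ger0_norm.
have i0 := ig_cst theta c0.
have j1 := igD i0 (igZ c1 i1).
have j2 := igD j1 (igZ c2 i2).
have j3 := igD j2 (igZ c3 i3).
have j4 := igD j3 (igZ b i4).
have fi : theta.-integrable setT (EFin \o (fun y => f (x - y))) by apply: bnd.
have le y : f (x - y) <= c0 + c1 * (chi y * r x y) + c2 * (chi y * r x y ^+ 2)
    + c3 * (chi y * `|r x y| ^+ 3) + b * (1 - chi y).
  case: (chi01 y) => [->|[-> ry]].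
    by rewrite !mul0r !mulr0 !addr0 subr0 mulr1.
  by rewrite !mul1r subrr mulr0 addr0 Hf.
have := E_le fi j4 le.
rewrite (ED j3 (igZ b i4)) (ED j2 (igZ c3 i3)) (ED j1 (igZ c2 i2)) (ED i0 (igZ c1 i1)).
rewrite !EZ// Ecst => /le_trans; apply.
move: (N x) q0 N1 m1 m2 m3 m4 => q q0 q1.
set a1 := \int[theta]_y (chi y * r x y); set a2 := \int[theta]_y _.
set a3 := \int[theta]_y _; set a4 := \int[theta]_y _ => m1 m2 m3 m4.
have h4 : b * a4 <= b * e / q ^+ 2.
  by rewrite -mulrA ler_wpM2l// ler_pdivlMr ?exprn_gt0// mulrC.
have h1 : c1 * (q * a1 - D) <= `|c1| * e.
  by apply: le_trans (ler_norm _) _; rewrite normrM ler_wpM2l.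
have h2 : c2 * (q * a2 - 4) <= `|c2| * e.
  by apply: le_trans (ler_norm _) _; rewrite normrM ler_wpM2l.
have h3 : c3 * (q * a3) <= c3 * e by rewrite ler_wpM2l.
have : c1 * a1 + c2 * a2 + c3 * a3 <=
    (c1 * D + 4 * c2 + e * (`|c1| + `|c2| + c3)) / q.
  by rewrite ler_pdivlMr//; move: h1 h2 h3; clear; lra.
by move: h4; clear; lra.
Qed.

Variable n0 : R.
Hypotheses (n0_gt0 : 0 < n0) (N_ge : forall x, x != 0 -> n0 <= N x).
Hypothesis D03 : 0 <= D <= 3.
Hypothesis increments_small : forall e, 0 < e ->
  exists2 Q, 1 <= Q & forall x, Q <= N x -> increment_bounds e x.
Hypothesis N_0 : N 0 = 0.
Variable u : Zd d -> R.
Hypothesis u01 : forall x, 0 <= u x <= 1.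
Hypothesis u_0 : u 0 = 1.
Hypothesis u_fixpoint : forall x, x != 0 -> u x = G (\int[theta]_y u (x - y)).

Definition root4 (t : R) : R := Num.sqrt (Num.sqrt t).

Lemma root4K t : 0 <= t -> root4 t ^+ 4 = t.
Proof.
by move=> t0; rewrite (exprM _ 2 2) !sqr_sqrtr// sqrtr_ge0.
Qed.

Lemma root4_ge0 t : 0 <= root4 t.
Proof. exact: sqrtr_ge0. Qed.

Lemma root4_gt0 t : 0 < t -> 0 < root4 t.
Proof. by move=> t0; rewrite !sqrtr_gt0. Qed.

Lemma root4_le s t : s <= t -> root4 s <= root4 t.
Proof. by move=> st; rewrite !ler_wsqrtr. Qed.

(** Supplies the [s] of the quarter-power expansions. Positivity of [N (x - y)] also keeps [x - y]
    off the origin, where the barriers have a separate value. *)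
Lemma root4_relinc x y : 0 < N x -> `|r x y| <= 2^-1 ->
  exists s, [/\ 0 < s, s ^+ 4 = 1 + r x y, 0 < N (x - y),
    N (x - y) = N x * s ^+ 4 & root4 (N (x - y)) = root4 (N x) * s].
Proof.
move=> q0 rxy.
have Nxy : N (x - y) = N x * (1 + r x y).
  by rewrite /relinc; field; exact: lt0r_neq0.
have r0 : 0 < 1 + r x y.
  by have := ler_normlP _ _ rxy; case; lra.
have Nxy0 : 0 < N (x - y) by rewrite Nxy mulr_gt0.
exists (root4 (1 + r x y)); rewrite root4_gt0// root4K ?ltW//.
split=> //; rewrite Nxy /root4 sqrtrM; last exact: ltW.
by rewrite sqrtrM// sqrtr_ge0.
Qed.

Local Notation p x := (root4 (N x)).
Local Notation c := (2 * (4 - D) / rho ^+ 2).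

Let rho2 : 0 < rho ^+ 2.
Proof. by rewrite exprn_gt0// (offspring_rho_gt0 hmu). Qed.

Let N_gt0 x : x != 0 -> 0 < N x.
Proof. by move=> x0; exact: lt_le_trans (N_ge x0). Qed.

Let nz_of_N x : 0 < N x -> x != 0.
Proof. by apply: contraTneq => ->; rewrite N_0 ltxx. Qed.

(* The term in [N ^ (-5/4)] makes the barrier exceed 1 near the origin, where
   the increments are not controlled. *)
Lemma upper_barrier e : 0 < e <= 1 ->
  exists B, forall x, x != 0 -> u x <= c * (1 + e) / N x + B / p x ^+ 5.
Proof.
move=> e01; have [e0 e1] := andP e01; have [D0 D3] := andP D03.
pose A := c * (1 + e); pose k := rho ^+ 2 / 2; pose kap := genrem mu 1.
have kap0 : 0 < kap by exact: genrem1_gt0.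
have k0 : 0 < k by rewrite divr_gt0.
have A0 : 0 < A by rewrite mulr_gt0 ?divr_gt0//; lra.
have kA : k * A = (4 - D) * (1 + e) by rewrite /k /A; field; exact: lt0r_neq0 (offspring_rho_gt0 hmu).
(* [6412 = 4 * 1603], where 1603 is the constant of [expansion_coefficients]. *)
pose ep := Num.min (e / 6412) (e * A / 4).
have eA0 : 0 < e * A by rewrite mulr_gt0.
have ep0 : 0 < ep by rewrite lt_min; apply/andP; split; lra.
have ep1 : 1603 * ep <= e / 4.
  have : ep <= e / 6412 by rewrite ge_min lexx.
  lra.
have ep2 : ep <= e * A / 4 by rewrite ge_min lexx orbT.
have [s0 /andP[s00 s01] Hs0] := genrem_near0 hmu (divr_gt0 (mulr_gt0 k0 e0) (ltr0n _ 4)).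
have [Q1 Q11 HQ1] := increments_small ep0.
(* The second entry forces [S <= s0] in the last case below, where [H < 8 / kap] and
   [S <= 9 * H / N x]. The choice of [B] makes [h >= 1] wherever [N <= Q]. *)
pose Q := Num.max Q1 (72 / (kap * s0)).
have ks0 : 0 < kap * s0 by rewrite mulr_gt0.
have Q0 : 0 < Q by rewrite lt_max (lt_le_trans ltr01 Q11).
pose B := root4 Q ^+ 5.
have B0 : 0 < B by rewrite exprn_gt0// root4_gt0.
exists B.
pose h x := A / N x + B / p x ^+ 5.
have h0 x : x != 0 -> 0 < h x.
  by move=> x0; rewrite addr_gt0 ?divr_gt0 ?exprn_gt0 ?root4_gt0 ?N_gt0.
pose U x := if x == 0 then 1 else Num.min 1 (h x).
have U01 x : 0 <= U x <= 1.
  rewrite /U; case: eqVneq => [_|x0]; first by rewrite ler01 lexx.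
  by rewrite le_min ler01 (ltW (h0 _ x0)) ge_min lexx.
have Ule x : x != 0 -> U x <= h x.
  by move=> x0; rewrite /U (negPf x0) ge_min lexx orbT.
suff uU x : u x <= U x by move=> x x0; apply: le_trans (uU x) (Ule x x0).
apply: (comparison hmu (theta := theta) U01 u01) => {}x.
have [->|x0] := eqVneq x 0; first by left; rewrite u_0 /U eqxx.
have [h1|h1] := leP 1 (h x).
  by left; rewrite /U (negPf x0) (min_idPl h1); case/andP: (u01 x).
right; rewrite -u_fixpoint// lexx; split=> //.
have -> : U x = h x by rewrite /U (negPf x0); apply/min_idPr/ltW.
have q0 := N_gt0 x0; have p0 : 0 < p x by rewrite root4_gt0.
have NQ : Q <= N x.
  rewrite leNgt; apply/negP => NQ.
  suff : 1 <= h x by rewrite leNgt h1.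
  apply: (@le_trans _ _ (B / p x ^+ 5)); last by rewrite lerDr divr_ge0// ltW.
  rewrite ler_pdivlMr ?exprn_gt0// mul1r lerXn2r ?nnegrE ?root4_ge0//.
  by rewrite root4_le// ltW.
have NQ1 : Q1 <= N x by apply: le_trans NQ; rewrite le_max lexx.
have NQ2 : 72 / (kap * s0) <= N x by apply: le_trans NQ; rewrite le_max lexx orbT.
have N1 : 1 <= N x := le_trans Q11 NQ1.
pose b := B / p x ^+ 5; pose a := A / N x.
have a0 : 0 <= a by rewrite divr_ge0// ltW.
have b0 : 0 <= b by rewrite divr_ge0// ltW// exprn_gt0.
have Uabs y : `|U y| <= 1 by have /andP[? ?] := U01 y; rewrite ger0_norm.
have c30 : 0 <= 2 * a + 1600 * b.
  exact: addr_ge0 (mulr_ge0 (ler0n R 2) a0) (mulr_ge0 (ler0n R 1600) b0).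
have expand y : `|r x y| <= 2^-1 -> U (x - y) <= (a + b) + (- a - 5 / 4 * b) * r x y
    + (a + 45 / 32 * b) * r x y ^+ 2 + (2 * a + 1600 * b) * `|r x y| ^+ 3.
  move=> rxy; have [s [s_0 s4 Nxy0 Nxy pxy]] := root4_relinc q0 rxy.
  apply: le_trans (Ule _ (nz_of_N Nxy0)) _.
  have -> : h (x - y) = a * s ^- 4 + b * s ^- 5.
    by rewrite /h pxy Nxy exprMn (invfM (N x)) (invfM (p x ^+ 5)) 2!mulrA.
  have := ler_wpM2l a0 (inv_le s4 rxy).
  have := ler_wpM2l b0 (pow5_inv_le s_0 s4 rxy).
  by move: (`|r x y| ^+ 3) (s ^- 4) (s ^- 5) => *; lra.
have := expectation_le (HQ1 x NQ1) N1 Uabs c30 ler01 expand.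
have U1 y : U y <= a + b + 1 by case/andP: (U01 y) => _ /le_trans; apply; rewrite lerDr addr_ge0.
move=> /(_ U1).
set S := \int[theta]_y U (x - y) => Sle.
have Su : 0 <= S <= 1 by apply: (E_in01 (@Zd_measurable d)).
have [S0 S1] := andP Su.
(* Since [G S <= S], only an average above [h x] requires work. *)
have [Sh|hS] := leP S (h x).
  apply: le_trans Sh; rewrite /hitfun gerBl mulr_ge0 ?sqr_ge0//.
  by apply: le_trans (genrem_anti hmu S0 S1 (lexx 1)); rewrite ltW.
pose H := A + b * N x.
have bN0 : 0 <= b * N x by rewrite mulr_ge0// ltW.
have [dl8 dlk] := supersolution_arith e01 A0 bN0 (erefl H) D03 kA ep0 ep1 ep2.
move: dl8 dlk; set dl := (X in X <= 8 * H) => dl8 dlk.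
have hH : h x = H / N x by rewrite /h -/a -/b /H mulrDl mulfK ?gt_eqF.
have Sdl : S <= h x + dl / N x ^+ 2.
  apply: (le_trans Sle); rewrite -addrA lerD2l.
  apply: supersolution_increment => //; [exact: ltW|exact: ltW|].
  exact: expansion_coefficients.
have H0 : 0 < H by rewrite /H ltr_wpDr.
have hx0 := h0 x x0.
suff dlE : dl / N x ^+ 2 <= h x ^+ 2 * genrem mu S.
  have gS : 0 <= genrem mu S.
    by apply: le_trans (genrem_anti hmu S0 S1 (lexx 1)); rewrite ltW.
  have : h x ^+ 2 * genrem mu S <= S ^+ 2 * genrem mu S.
    by rewrite ler_wpM2r// lerXn2r ?nnegrE// ltW.
  by rewrite /hitfun; move: Sdl dlE; clear; lra.
rewrite hH expr_div_n mulrAC ler_wpM2r ?invr_ge0 ?sqr_ge0//.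
(* [H] may be large, as [B] grows with [Q]. Then the crude bound [kap <= genrem mu S] is enough,
   because [8 * H <= kap * H ^+ 2]; otherwise [S] is small and [genrem] is close to
   [rho ^+ 2 / 2]. *)
have [Hbig|Hsmall] := leP (8 / kap) H.
  apply: (le_trans dl8); apply: (@le_trans _ _ (H ^+ 2 * kap)).
    by rewrite expr2 mulrAC ler_wpM2r ?(ltW H0)// -ler_pdivrMr.
  by rewrite ler_wpM2l ?sqr_ge0// genrem_anti.
have SS0 : S <= s0.
  apply: (le_trans Sdl).
  have d8 : dl / N x ^+ 2 <= 8 * H / N x.
    rewrite expr2 invfM mulrA ler_wpM2r ?invr_ge0 ?(ltW q0)//.
    rewrite ler_pdivrMr//; apply: (le_trans dl8).
    by rewrite ler_peMr// mulr_ge0// ltW.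
  apply: (@le_trans _ _ (9 * H / N x)).
    have -> : 9 * H / N x = H / N x + 8 * H / N x by ring.
    by rewrite hH lerD2l; exact: d8.
  rewrite ler_pdivrMr//; move: NQ2; rewrite ler_pdivrMr// => NQ2.
  apply: (@le_trans _ _ (9 * (8 / kap))); first by rewrite ler_wpM2l// ltW.
  rewrite mulrA ler_pdivrMr// [s0 * N x]mulrC -mulrA [s0 * kap]mulrC.
  by apply: le_trans NQ2; rewrite -natrM.
have := Hs0 S; rewrite S0 SS0 => /(_ isT) gS.
by apply: (le_trans dlk); rewrite mulrC ler_wpM2l ?sqr_ge0.
Qed.

Hypothesis u_gt0 : forall Q, exists2 m, 0 < m & forall x, N x < Q -> m <= u x.

(* [K] is so large that the barrier is below the minimum of [u] near the
   origin, where the increments are not controlled. *)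
Lemma lower_barrier e : 0 < e <= 1 -> exists2 K, 0 <= K &
  forall x, x != 0 -> c * (1 - e) / (N x + K * p x ^+ 3) <= u x.
Proof.
move=> e01; have [e0 e1] := andP e01; have [D0 D3] := andP D03.
pose A := c * (1 - e); pose k := rho ^+ 2 / 2.
have A0 : 0 <= A by rewrite mulr_ge0 ?subr_ge0// divr_ge0 ?(ltW rho2)// mulr_ge0//; lra.
have kA : k * A = (4 - D) * (1 - e).
  by rewrite /k /A; field; exact: lt0r_neq0 (offspring_rho_gt0 hmu).
pose ep := e / 432.
have ep0 : 0 < ep by rewrite /ep; lra.
have ep1 : 432 * ep <= 1 by rewrite /ep; lra.
have ep2 : 108 * ep <= e by rewrite /ep; lra.
have [Q1 Q11 HQ1] := increments_small ep0.
(* [42 / e] serves [subsolution_arith]; the entry [A] gives [V <= 1] wherever [Q <= N]. *)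
pose Q := Num.max Q1 (Num.max (42 / e) A).
have [m m0 Hm] := u_gt0 Q.
have m1 : m <= 1.
  apply: (@le_trans _ _ (u 0)); last by case/andP: (u01 0).
  by apply: Hm; rewrite N_0 lt_max (lt_le_trans ltr01 Q11).
(* Off the origin [p x >= root4 n0], so [K * p x ^+ 3 >= A / m] and the barrier is at most [m]. *)
pose K := A / (m * root4 n0 ^+ 3).
have K0 : 0 <= K by rewrite divr_ge0// mulr_ge0 ?exprn_ge0 ?root4_ge0// ltW.
exists K => //.
pose den x := N x + K * p x ^+ 3.
have den_ge x : x != 0 -> N x <= den x.
  by move=> x0; rewrite lerDl mulr_ge0// exprn_ge0// root4_ge0.
have den0 x : x != 0 -> 0 < den x.
  by move=> x0; apply: lt_le_trans (den_ge x x0); exact: N_gt0.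
pose V x := if x == 0 then 0 else A / den x.
have Vx x : x != 0 -> V x = A / den x by move=> /negPf x0; rewrite /V x0.
have V0 x : 0 <= V x.
  rewrite /V; case: eqVneq => // x0.
  by rewrite divr_ge0// ltW// den0.
have Vsmall x : x != 0 -> N x < Q -> V x <= m.
  move=> x0 NQ; rewrite Vx// ler_pdivrMr ?den0//.
  apply: (@le_trans _ _ (m * (K * p x ^+ 3))); last first.
    by rewrite ler_wpM2l ?(ltW m0)// lerDr (ltW (N_gt0 x0)).
  have r0 : 0 < root4 n0 ^+ 3 by rewrite exprn_gt0// root4_gt0.
  apply: (@le_trans _ _ (m * (K * root4 n0 ^+ 3))).
    rewrite [K * _]mulrC mulrA mulrC divfK//.
    by rewrite mulf_neq0 ?lt0r_neq0.
  rewrite ler_wpM2l ?(ltW m0)// ler_wpM2l// lerXn2r ?nnegrE ?root4_ge0//.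
  by rewrite root4_le// N_ge.
have Vlarge x : Q <= N x -> V x <= 1.
  have [->|x0] := eqVneq x 0; first by rewrite /V eqxx ler01.
  move=> QN; rewrite Vx// ler_pdivrMr ?den0// mul1r.
  by apply: le_trans (den_ge _ x0); apply: le_trans QN; rewrite !le_max lexx !orbT.
have V1 x : V x <= 1.
  have [->|x0] := eqVneq x 0; first by rewrite /V eqxx ler01.
  have [|NQ] := leP Q (N x); first exact: Vlarge.
  by apply: le_trans m1; exact: Vsmall.
have V01 x : 0 <= V x <= 1 by rewrite V0 V1.
suff Vu x : V x <= u x by move=> x x0; rewrite -[X in X <= _](Vx x x0).
apply: (comparison hmu (theta := theta) u01 V01) => {}x.
have [->|x0] := eqVneq x 0; first by left; rewrite /V eqxx; case/andP: (u01 0).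
have [NQ|QN] := ltP (N x) Q.
  by left; apply: le_trans (Hm x NQ); exact: Vsmall.
right; rewrite -u_fixpoint// lexx; split=> //.
have q0 := N_gt0 x0; have p0 : 0 < p x by rewrite root4_gt0.
have QN1 : Q1 <= N x by apply: le_trans QN; rewrite le_max lexx.
have eN : 42 <= e * N x.
  rewrite mulrC -ler_pdivrMr//; apply: le_trans QN.
  by rewrite !le_max lexx orbT.
have N1 : 1 <= N x := le_trans Q11 QN1.
have d0 := den0 x x0.
pose z := N x / den x.
have z01 : 0 <= z <= 1.
  by rewrite divr_ge0 ?(ltW q0) ?(ltW d0)//= ler_pdivrMr// mul1r den_ge.
have z1 : 1 - z = K * p x ^+ 3 / den x.
  by rewrite /z -(divff (lt0r_neq0 d0)) -mulrBl /den addrC addKr.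
pose v := V x; have v0 : 0 <= v by exact: V0.
have vz : v = A * z / N x by rewrite /v Vx// /z [N x / _]mulrC mulrA mulfK// lt0r_neq0.
set n1 := (3 + z) / 4; set mm := n1 ^+ 2 + 3 / 32 * (1 - z).
have [M0 HM] := subsolution_arith e01 D03 ep1 ep2 z01 eN N1 ep0.
move: M0 HM; rewrite -/n1 -/mm; set M := 4 * mm - _ - _ => M0 HM.
have n10 : 0 <= n1 by rewrite /n1; case/andP: z01; lra.
have mm0 : 0 <= mm.
  by rewrite addr_ge0 ?sqr_ge0// mulr_ge0//; case/andP: z01; lra.
(* [expectation_le] yields upper bounds, hence the sign. After a large jump only [0 <= V] is used,
   at the cost [v]. *)
have expand y : `|r x y| <= 2^-1 -> -1 * V (x - y) <= - v + (n1 * v) * r x y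
    + (- (mm * v)) * r x y ^+ 2 + 50 * v * `|r x y| ^+ 3.
  move=> rxy; have [s [s_0 s4 Nxy0 Nxy pxy]] := root4_relinc q0 rxy.
  have -> : V (x - y) = v * (z * s ^+ 4 + (1 - z) * s ^+ 3)^-1.
    rewrite Vx; last exact: nz_of_N.
    rewrite /v Vx// z1 /z /den pxy Nxy exprMn.
    rewrite -mulrA -invfM; congr (_ / _).
    rewrite [K * (_ * _)]mulrA; move: (lt0r_neq0 d0); rewrite /den.
    by move: (N x) (K * p x ^+ 3) (s ^+ 4) (s ^+ 3) => a b s' s'' ab; field.
  have := ler_wpM2l v0 (mix_inv_ge s_0 s4 rxy z01).
  rewrite -/n1 -/mm.
  by move: (`|r x y| ^+ 3) (_^-1) (r x y ^+ 2) (r x y) => *; lra.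
have Vabs y : `|-1 * V y| <= 1 by rewrite mulN1r normrN ger0_norm.
have c30 : 0 <= 50 * v by rewrite mulr_ge0.
have Vneg y : -1 * V y <= - v + v by rewrite mulN1r addNr oppr_le0.
have := expectation_le (f := fun y => -1 * V y) (HQ1 x QN1) N1 Vabs c30 v0 expand Vneg.
have iV : theta.-integrable setT (EFin \o (fun y => V (x - y))) by apply: ig_in01.
rewrite EZ//.
have /andP[S0 S1] : 0 <= \int[theta]_y V (x - y) <= 1.
  by apply: (E_in01 (@Zd_measurable d)).
set S := \int[theta]_y V (x - y) in S0 S1 * => Sge.
(* A lower bound for the average of [V]. By monotonicity of [G] and [hitfun_ge] it remains to see
   that the loss [k * t ^+ 2] is at most the gain [v * (M / N x)]. *)
pose t := v * (1 + M / N x).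
have tS : t <= S.
  have E : v * ep / N x ^+ 2 <= v * ep / N x.
    rewrite expr2 invfM mulrA ler_piMr ?invf_le1//.
    exact: (divr_ge0 (mulr_ge0 v0 (ltW ep0)) (ltW q0)).
  have nn : `|n1 * v| = n1 * v by rewrite ger0_norm// mulr_ge0.
  have nm : `|- (mm * v)| = mm * v by rewrite normrN ger0_norm// mulr_ge0.
  move: Sge; rewrite nn nm => Sge.
  have gen (w n l q ep' D' : R) : q != 0 ->
      w * (1 + (4 * l - n * D' - ep' * (n + l + 51)) / q) =
      w - (n * w * D' + 4 * - (l * w) + ep' * (n * w + l * w + 50 * w)) / q
        - w * ep' / q by move=> ?; field.
  rewrite /t /M gen; last exact: lt0r_neq0.
  move: Sge E; move: (_ / N x) (v * ep / N x) (_ / N x ^+ 2) => g1 g2 g3 Sge E.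
  by rewrite -subr_ge0; move: Sge E; rewrite mulN1r; lra.
have t0 : 0 <= t by rewrite mulr_ge0// addr_ge0// divr_ge0// ltW.
apply: le_trans (hitfun_le hmu t0 tS S1).
have t01 : 0 <= t <= 1 by rewrite t0 (le_trans tS).
apply: le_trans (hitfun_ge hmu t01).
rewrite -/k -/v.
have : k * t ^+ 2 <= v * (M / N x).
  have -> : k * t ^+ 2 = v / N x * ((4 - D) * (1 - e) * z * (1 + M / N x) ^+ 2).
    have kv : k * v = (4 - D) * (1 - e) * z / N x by rewrite vz [LHS]mulrA; congr (_ / _); rewrite mulrA kA.
    have gen (k' w w' q X : R) : k' * w = X / q ->
        k' * (w * w') ^+ 2 = w / q * (X * w' ^+ 2).
      move=> h; have -> : k' * (w * w') ^+ 2 = w * w' ^+ 2 * (k' * w) by ring.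
      by rewrite h; ring.
    exact: gen.
  rewrite [leRHS]mulrA [leRHS]mulrAC; apply: ler_wpM2l => //.
  exact: divr_ge0 v0 (ltW q0).
by rewrite {2}/t mulrDr mulr1 -addrA lerDl subr_ge0.
Qed.

End radial_barriers.

Lemma E_abs_le {disp : measure_display} {T : measurableType disp} {R : realType}
    (mT : forall A : set T, measurable A) (P : probability T R) (f g : T -> R) :
  (forall x, `|f x| <= g x) -> P.-integrable setT (EFin \o g) ->
  `|\int[P]_x f x| <= \int[P]_x g x.
Proof.
move=> fg ig; have if_ := le_ig mT fg ig.
have ia := integrable_norm if_.
apply: le_trans (le_normr_Rintegral measurableT if_) _.
exact: E_le.
Qed.

(** * Increments of the normalised walk *)

Section euclidean.
Context {R : realFieldType}.

Definition dotv n (v w : 'cV[R]_n) : R := \sum_i v i 0 * w i 0.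

Lemma dotvE n (v w : 'cV[R]_n) : dotv v w = (v^T *m w) 0 0.
Proof. by rewrite mxE; apply: eq_bigr => i _; rewrite mxE. Qed.

Lemma dotvC n (v w : 'cV[R]_n) : dotv v w = dotv w v.
Proof. by apply: eq_bigr => i _; rewrite mulrC. Qed.

Lemma dotvBr n (u v w : 'cV[R]_n) : dotv u (v - w) = dotv u v - dotv u w.
Proof. by rewrite !dotvE mulmxBr mxE [X in _ + X]mxE. Qed.

Lemma dotvv_ge0 n (v : 'cV[R]_n) : 0 <= dotv v v.
Proof. by apply: sumr_ge0 => i _; rewrite -expr2 sqr_ge0. Qed.

Lemma dotvv_eq0 n (v : 'cV[R]_n) : (dotv v v == 0) = (v == 0).
Proof.
apply/eqP/eqP => [|->]; last by rewrite /dotv big1// => i _; rewrite mxE mulr0.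
move=> v0; apply/colP => i; rewrite mxE.
have /psumr_eq0P : forall i, true -> 0 <= v i 0 * v i 0.
  by move=> j _; rewrite -expr2 sqr_ge0.
by move=> /(_ v0 i isT) /eqP; rewrite -expr2 sqrf_eq0 => /eqP.
Qed.

Lemma dotvv_sub n (v w : 'cV[R]_n) :
  dotv (v - w) (v - w) = dotv v v - 2 * dotv v w + dotv w w.
Proof. by rewrite dotvBr ![dotv (v - w) _]dotvC !dotvBr (dotvC w v); ring. Qed.

(** Lagrange's identity: the squared 2 by 2 minors sum to twice the gap. *)
Lemma cauchy_schwarz n (v w : 'cV[R]_n) : dotv v w ^+ 2 <= dotv v v * dotv w w.
Proof.
have : 0 <= \sum_i \sum_j (v i 0 * w j 0 - v j 0 * w i 0) ^+ 2.
  by apply: sumr_ge0 => i _; apply: sumr_ge0 => j _; rewrite sqr_ge0.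
have e (a b c f : 'I_n -> R) : (\sum_i a i * b i) * (\sum_i c i * f i) =
    \sum_i \sum_j (a i * b i) * (c j * f j).
  by rewrite mulr_suml; apply: eq_bigr => i _; rewrite mulr_sumr.
suff -> : \sum_i \sum_j (v i 0 * w j 0 - v j 0 * w i 0) ^+ 2 =
    2 * (dotv v v * dotv w w - dotv v w ^+ 2) by rewrite pmulr_rge0// subr_ge0.
rewrite expr2 /dotv !e mulrBr mulr_natl mulr2n [in LHS](eq_bigr (fun i =>
  (\sum_j (v i 0 * v i 0) * (w j 0 * w j 0) + \sum_j (v j 0 * v j 0) * (w i 0 * w i 0))
    - 2 * \sum_j (v i 0 * w i 0) * (v j 0 * w j 0))); last first.
  move=> i _; rewrite mulr_sumr -big_split -sumrB; apply: eq_bigr => j _ /=; ring.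
rewrite sumrB big_split -mulr_sumr; congr (_ + _ - _).
by rewrite exchange_big.
Qed.

Lemma dotv_mulmx_le n (A : 'M[R]_n) : exists2 C, 0 < C &
  forall v : 'cV[R]_n, dotv (A *m v) (A *m v) <= C * dotv v v.
Proof.
pose C := \sum_i dotv (row i A)^T (row i A)^T.
have C0 : 0 <= C by apply: sumr_ge0 => i _; exact: dotvv_ge0.
(* Adding 1 keeps the constant positive when [A = 0]. *)
exists (C + 1) => [|v]; first by lra.
apply: (@le_trans _ _ (C * dotv v v)); last by have := dotvv_ge0 v; lra.
rewrite /C mulr_suml; apply: ler_sum => i _; rewrite -expr2.
have -> : (A *m v) i 0 = dotv (row i A)^T v.
  by rewrite mxE; apply: eq_bigr => j _; rewrite !mxE.
exact: cauchy_schwarz.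
Qed.

End euclidean.

(** * Second moments of the jump law *)

Section second_moment.
Context {R : realType} {d : nat}.
Variable theta : probability (Zd d) R.
Hypothesis htheta : jump_assumptions theta.

Local Notation ig f := (theta.-integrable setT (EFin \o f)).
Local Notation mZ := (@Zd_measurable d).
Local Notation vec x := (Zd_to_R R x).

Definition sqnorm (x : Zd d) : R := dotv (vec x) (vec x).

Lemma enorm_sq (v : 'cV[R]_d) : enorm v ^+ 2 = dotv v v.
Proof.
rewrite /enorm sqr_sqrtr; first by apply: eq_bigr => i _; rewrite expr2.
by apply: sumr_ge0 => i _; rewrite sqr_ge0.
Qed.

Lemma sqnorm_ge0 x : 0 <= sqnorm x.
Proof. exact: dotvv_ge0. Qed.

Lemma lt_enorm (s : R) x : 0 <= s -> (s < enorm (vec x)) = (s ^+ 2 < sqnorm x).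
Proof. by move=> s0; rewrite /sqnorm -enorm_sq ltr_sqr ?nnegrE ?sqrtr_ge0. Qed.

Lemma jump_tail_bound e : 0 < e -> exists2 s0, 1 <= s0 & forall s, s0 <= s ->
  s ^+ 4 * fine (theta [set x | s ^+ 2 < sqnorm x]) <= e.
Proof.
move=> e0; have /cvgrPdist_le/(_ e e0)[M [_ HM]] := jump_tail htheta.
exists (Num.max 1 (M + 1)) => [|s]; first by rewrite le_max lexx.
rewrite ge_max => /andP[s1 sM]; have := HM s; rewrite sub0r normrN.
move=> /(_ (lt_le_trans _ sM)); rewrite ltrDl ltr01 => /(_ isT) /ler_normlP[_].
have -> : [set x | s < enorm (vec x)] = [set x | s ^+ 2 < sqnorm x].
  by apply/seteqP; split=> x /=; rewrite lt_enorm// (le_trans ler01).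
by [].
Qed.

Lemma E_indic A : \int[theta]_x \1_A x = fine (theta A).
Proof. by rewrite /Rintegral integral_indic// setIT. Qed.

Lemma ig_indic A : ig (\1_A).
Proof.
apply: (@ig_bounded _ _ _ mZ theta 1) => x.
by rewrite indicE; case: (_ \in _); rewrite ?normr1// normr0.
Qed.

(** Dyadic decomposition: by the fourth-order tail the shell at radius [2 ^+ j * s0] contributes at
    most [4 / 4 ^+ j]. The step function [g J] dominates [sqnorm] only on a ball, which suffices
    because an unordered sum is tested on finite sets. *)
Lemma ig_sqnorm : ig sqnorm.
Proof.
have [s0 s01 tail] := jump_tail_bound ltr01.
have s00 : 0 < s0 := lt_le_trans ltr01 s01.
pose A j := [set x | (2 ^+ j * s0) ^+ 2 < sqnorm x].
pose cc j : R := (2 ^+ j.+1 * s0) ^+ 2.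
pose g J x := cst (s0 ^+ 2) x + \sum_(j < J) cc j * \1_(A j) x.
have igA j : ig (fun x => cc j * \1_(A j) x) by apply: igZ; exact: ig_indic.
have gE J : \int[theta]_x g J x <= s0 ^+ 2 + 8 - 8 * (4 ^+ J)^-1.
  rewrite ED; [|exact: ig_cst|exact: ig_sum].
  rewrite Ecst -addrA lerD2l E_sum//.
  elim: J => [|J IH]; first by rewrite big_ord0 expr0; lra.
  rewrite big_ord_recr /= EZ; last exact: ig_indic.
  rewrite E_indic.
  have t0 : 0 < 2 ^+ J * s0 by rewrite mulr_gt0// exprn_gt0.
  have := tail (2 ^+ J * s0) _; rewrite ler_peMl ?exprn_ege1 ?ler1n//; last exact: ltW.
  move=> /(_ isT) h.
  have h' : cc J * fine (theta (A J)) <= 4 * (4 ^+ J)^-1.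
    have -> : cc J = 4 * (2 ^+ J * s0) ^+ 2.
      by rewrite /cc [2 ^+ J.+1]exprS -mulrA exprMn; congr (_ * _); rewrite -natrX.
    rewrite -mulrA ler_wpM2l// -[leRHS]mul1r ler_pdivlMr ?exprn_gt0//.
    have e4 (w : R) : w ^+ 4 = w ^+ 2 * w ^+ 2 by rewrite -exprD.
    apply: le_trans h; rewrite mulrC e4 -[leRHS]mulrA.
    apply: ler_wpM2r; first by rewrite mulr_ge0 ?sqr_ge0 ?fine_ge0.
    rewrite exprMn -exprM mulnC exprM -[2 ^+ 2]natrX ler_peMr ?exprn_ge0//.
    by rewrite exprn_ege1.
  have -> : (4 ^+ J.+1)^-1 = (4 ^+ J)^-1 / 4 :> R by rewrite exprSr invfM.
  have : 0 <= (4 ^+ J)^-1 :> R by rewrite invr_ge0 exprn_ge0.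
  by move: IH h'; lra.
have g0 J x : 0 <= g J x.
  rewrite addr_ge0 ?sqr_ge0//; apply: sumr_ge0 => j _.
  by rewrite mulr_ge0 ?sqr_ge0.
have sqg J x : sqnorm x <= (2 ^+ J * s0) ^+ 2 -> sqnorm x <= g J x.
  rewrite /g; elim: J => [|J IH] xJ; first by rewrite big_ord0 addr0 (le_trans xJ)// expr0 mul1r.
  rewrite big_ord_recr/=.
  have [/IH h|h] := leP (sqnorm x) ((2 ^+ J * s0) ^+ 2).
    by rewrite addrA (le_trans h)// lerDl mulr_ge0 ?sqr_ge0.
  rewrite indicE mem_set// mulr1 addrA (le_trans xJ)// lerDr.
  exact: (g0 J x).
apply/integrableP; split; first by move=> ? ? ?; exact: mZ.
under eq_integral => x _ do rewrite /= ger0_norm ?sqnorm_ge0//.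
rewrite (integral_discrete mZ theta (pcan_inj (@pickleK _)) sqnorm_ge0).
apply: (@le_lt_trans _ _ (s0 ^+ 2 + 8)%:E); last exact: ltry.
apply: ge_ereal_sup => _ [X [/finite_seqP[r Xr] _] <-].
have [J HJ] : exists J, forall x, x \in r -> sqnorm x <= (2 ^+ J * s0) ^+ 2.
  pose M := \sum_(x <- r) sqnorm x.
  exists (Num.truncn M).+1 => x xr.
  have xM : sqnorm x <= M.
    by rewrite /M (big_rem x xr)/= lerDl sumr_ge0// => ? _; exact: sqnorm_ge0.
  apply: (le_trans xM); apply: (le_trans (ltW (truncnS_gt M))).
  apply: (@le_trans _ _ (2 ^+ (Num.truncn M).+1)).
    by rewrite -natrX ler_nat ltnW// ltn_expl.
  have : 1 <= 2 ^+ (Num.truncn M).+1 :> R by rewrite exprn_ege1// ler1n.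
  move: (2 ^+ _) => w w1; have ws : w <= w * s0 by rewrite ler_peMr// (le_trans ler01).
  have ws1 := le_trans w1 ws.
  by rewrite (le_trans ws)// expr2 ler_peMr// (le_trans ler01).
apply: (@le_trans _ _ (\sum_(x \in X) (g J x * fine (theta [set x]))%:E)).
  apply: lee_fsum; first by apply/finite_seqP; exists r.
  move=> x Xx; rewrite lee_fin ler_wpM2r ?fine_ge0// sqg//.
  by apply: HJ; rewrite Xr in Xx.
apply: (@le_trans _ _ (\int[theta]_x (g J x)%:E)%E).
  rewrite (integral_discrete mZ theta (pcan_inj (@pickleK _)))//.
  by apply: esum_ge; exists X => //; split=> //; apply/finite_seqP; exists r.
have igg : ig (g J) by apply: igD; [exact: ig_cst|exact: ig_sum].
rewrite -(fineK (integrable_fin_num measurableT igg)) lee_fin.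
apply: le_trans (gE J) _; rewrite gerBl mulr_ge0// invr_ge0 exprn_ge0//.
Qed.

Lemma sqnorm_tail e : 0 < e -> exists K : R,
  \int[theta]_x (sqnorm x * \1_[set y | K < sqnorm y] x) <= e.
Proof.
move=> e0.
have igt (K : R) : ig (fun x => sqnorm x * \1_[set y | K < sqnorm y] x).
  apply: (le_ig mZ (g := sqnorm)); last exact: ig_sqnorm.
  move=> x; rewrite indicE; have s0 := sqnorm_ge0 x.
  by case: (_ \in _); rewrite ?mulr1 ?mulr0 ?normr0// ger0_norm.
have [] := @dominated_convergence _ _ _ theta setT measurableT
  (fun (n : nat) x => (sqnorm x * \1_[set y | n%:R < sqnorm y] x)%:E) (fun=> 0%E)
  (EFin \o sqnorm).
- by move=> n ? ? ?; exact: mZ.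
- by move=> ? ? ?; exact: mZ.
- apply: aeW => x _; apply: (@cvg_near_cst _ _ _ _ _ _).
  exists (Num.truncn (sqnorm x)).+1 => // n /= xn.
  rewrite indicE memNset ?mulr0//= => /lt_trans /(_ (truncnS_gt _)).
  by rewrite ltr_nat ltnNge xn.
- exact: ig_sqnorm.
- apply: aeW => x n _ /=; rewrite lee_fin indicE; have s0 := sqnorm_ge0 x.
  by case: (_ \in _); rewrite ?mulr1 ?mulr0 ?normr0// ger0_norm.
move=> _ _; rewrite integral0 => /fine_cvg /cvgrPdist_le /(_ e e0) [n _ /(_ n (leqnn _))] /=.
by rewrite sub0r normrN => h; exists n%:R; exact: le_trans (ler_norm _) h.
Qed.

Lemma coordE (i : 'I_d) (x : Zd d) : Defs.coord R i x = vec x i 0.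
Proof. by rewrite /Defs.coord /Zd_to_R mxE. Qed.

Lemma ig_dot2 (v w : 'cV[R]_d) : ig (fun y => dotv v (vec y) * dotv w (vec y)).
Proof.
apply: (le_ig mZ (g := fun y => (dotv v v + dotv w w) * sqnorm y)); last first.
  by apply: igZ; exact: ig_sqnorm.
move=> y; have := cauchy_schwarz v (vec y); have := cauchy_schwarz w (vec y).
rewrite -/(sqnorm y) ler_norml => h1 h2.
have := sqr_ge0 (dotv v (vec y) + dotv w (vec y)).
have := sqr_ge0 (dotv v (vec y) - dotv w (vec y)).
have : 0 <= dotv v v * sqnorm y by rewrite mulr_ge0 ?dotvv_ge0 ?sqnorm_ge0.
have : 0 <= dotv w w * sqnorm y by rewrite mulr_ge0 ?dotvv_ge0 ?sqnorm_ge0.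
move: h1 h2; move: (dotv v (vec y)) (dotv w (vec y)) => a b.
by rewrite mulrDl; move: (_ * sqnorm y) (dotv v v * _) => A B *; nra.
Qed.

Lemma dotv_delta i (v : 'cV[R]_d) : dotv (delta_mx i 0) v = v i 0.
Proof.
rewrite /dotv (bigD1 i)//= big1 ?addr0 ?mxE ?eqxx ?mul1r// => j ji.
by rewrite mxE (negPf ji) mul0r.
Qed.

Lemma ig_coord i : ig (fun y => vec y i 0).
Proof.
apply: (le_ig mZ (g := fun y => cst 1 y + dotv (delta_mx i 0) (vec y) * dotv (delta_mx i 0) (vec y))).
  move=> y /=; rewrite dotv_delta; move: (vec y i 0) => a.
  by rewrite ler_norml; have := sqr_ge0 (a - 1); have := sqr_ge0 (a + 1); nra.
by apply: igD; [exact: ig_cst|exact: ig_dot2].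
Qed.

Lemma E_coord i : \int[theta]_y vec y i 0 = 0.
Proof.
have := congr1 fine (jump_centered htheta i); rewrite unlock => h.
by apply: etrans h; congr fine; apply: eq_integral => y _; rewrite coordE.
Qed.

Lemma cov_mxE i j : cov_mx theta i j = \int[theta]_y (vec y i 0 * vec y j 0).
Proof.
rewrite mxE unlock; have c0 k : fine 'E_theta[Defs.coord R k] = 0.
  by rewrite (jump_centered htheta).
rewrite unlock in c0 *; congr fine; apply: eq_integral => y _ /=.
by congr (_ * _)%:E; rewrite /= c0 subr0 coordE.
Qed.

Lemma E_dot v : \int[theta]_y dotv v (vec y) = 0.
Proof.
rewrite /dotv E_sum; last by move=> i; apply: igZ; exact: ig_coord.
rewrite big1// => i _; rewrite EZ ?E_coord ?mulr0//; exact: ig_coord.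
Qed.

Lemma ig_dot v : ig (fun y => dotv v (vec y)).
Proof. by apply: ig_sum => i; apply: igZ; exact: ig_coord. Qed.

Lemma E_dot2 v w : \int[theta]_y (dotv v (vec y) * dotv w (vec y)) =
  dotv v (cov_mx theta *m w).
Proof.
have ig2 i j : ig (fun y => vec y i 0 * vec y j 0).
  have := ig_dot2 (delta_mx i 0) (delta_mx j 0).
  by apply: eq_integrable => // y _ /=; rewrite !dotv_delta.
transitivity (\int[theta]_y (\sum_i \sum_j (v i 0 * w j 0) * (vec y i 0 * vec y j 0))).
  apply: eq_Rintegral => y _; rewrite /dotv mulr_suml; apply: eq_bigr => i _.
  by rewrite mulr_sumr; apply: eq_bigr => j _; rewrite mulrACA.
rewrite E_sum; last by move=> i; apply: ig_sum => j; exact: igZ.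
apply: eq_bigr => i _; rewrite E_sum; last by move=> j; exact: igZ.
rewrite mxE mulr_sumr; apply: eq_bigr => j _.
by rewrite EZ// -cov_mxE -mulrA [w j 0 * _]mulrC.
Qed.

End second_moment.

(** * Moment bounds for the increments of the squared normalised distance *)

Section normalised_walk.
Context {R : realType} {d : nat}.
Variable theta : probability (Zd d) R.
Hypothesis htheta : jump_assumptions theta.
Variable L : 'M[R]_d.
Hypothesis HL : L *m cov_mx theta *m L^T = 1%:M.
Hypothesis Lu : L \in unitmx.

Local Notation ig f := (theta.-integrable setT (EFin \o f)).
Local Notation mZ := (@Zd_measurable d).

Definition nvec (x : Zd d) : 'cV[R]_d := L *m Zd_to_R R x.
Definition nsq (x : Zd d) : R := dotv (nvec x) (nvec x).

Lemma nvecB x y : nvec (x - y) = nvec x - nvec y.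
Proof.
rewrite /nvec -mulmxBr; congr (_ *m _).
by apply/colP => i; rewrite !mxE rmorphB.
Qed.

Lemma nsqB x y : nsq (x - y) = nsq x - 2 * dotv (nvec x) (nvec y) + nsq y.
Proof. by rewrite /nsq nvecB dotvv_sub. Qed.

Lemma nsq_ge0 x : 0 <= nsq x.
Proof. exact: dotvv_ge0. Qed.

Lemma dotv_trmx n (A : 'M[R]_n) (v w : 'cV[R]_n) : dotv v (A *m w) = dotv (A^T *m v) w.
Proof. by rewrite !dotvE trmx_mul trmxK mulmxA. Qed.

Lemma ig_ndot2 v w : ig (fun y => dotv v (nvec y) * dotv w (nvec y)).
Proof. by under eq_fun do rewrite /nvec !dotv_trmx; exact: ig_dot2. Qed.

Lemma ig_ndot v : ig (fun y => dotv v (nvec y)).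
Proof. by under eq_fun do rewrite /nvec dotv_trmx; exact: ig_dot. Qed.

Lemma E_ndot v : \int[theta]_y dotv v (nvec y) = 0.
Proof.
rewrite -(E_dot htheta (L^T *m v)); apply: eq_Rintegral => y _.
by rewrite /nvec dotv_trmx.
Qed.

Lemma E_ndot2 v w : \int[theta]_y (dotv v (nvec y) * dotv w (nvec y)) = dotv v w.
Proof.
transitivity (\int[theta]_y (dotv (L^T *m v) (Zd_to_R R y) * dotv (L^T *m w) (Zd_to_R R y))).
  by apply: eq_Rintegral => y _; rewrite /nvec !dotv_trmx.
rewrite (E_dot2 htheta) -dotv_trmx; congr dotv.
by rewrite !mulmxA HL mul1mx.
Qed.

Lemma nsqE y : nsq y =
  \sum_i dotv (delta_mx i 0) (nvec y) * dotv (delta_mx i 0) (nvec y).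
Proof. by apply: eq_bigr => i _; rewrite !dotv_delta. Qed.

Lemma ig_nsq : ig nsq.
Proof.
have : ig (fun y => \sum_i dotv (delta_mx i 0) (nvec y) * dotv (delta_mx i 0) (nvec y)).
  by apply: ig_sum => i; exact: ig_ndot2.
by apply: eq_integrable => // y _ /=; rewrite -nsqE.
Qed.

Lemma E_nsq : \int[theta]_y nsq y = d%:R.
Proof.
transitivity (\int[theta]_y (\sum_i dotv (delta_mx i 0) (nvec y) * dotv (delta_mx i 0) (nvec y))).
  by apply: eq_Rintegral => y _; rewrite -nsqE.
rewrite E_sum; last by move=> i; exact: ig_ndot2.
under eq_bigr => i _ do rewrite E_ndot2 dotv_delta mxE !eqxx.
by rewrite sumr_const card_ord.
Qed.

Lemma nsq_le_sqnorm : exists2 C : R, 0 < C & forall x, nsq x <= C * sqnorm x.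
Proof. by have [C C0 HC] := dotv_mulmx_le L; exists C => // x; exact: HC. Qed.

Lemma sqnorm_le_nsq : exists2 C : R, 0 < C & forall x, sqnorm x <= C * nsq x.
Proof.
have [C C0 HC] := dotv_mulmx_le (invmx L); exists C => // x.
by have := HC (nvec x); rewrite /nvec mulKmx.
Qed.

(* [N (x - y) - N x = N y - 2 * b y], where the scalar product [b] of [x] with the
   jump has mean 0 and second moment [N x]; [chi] selects [N y <= h ^+ 2 * N x]. *)
Lemma nsq_increments e : 0 < e -> exists2 Q, 1 <= Q &
  forall x, Q <= nsq x -> increment_bounds theta nsq d%:R e x.
Proof.
move=> e0; have [C C0 HC] := nsq_le_sqnorm.
have dd0 : 0 <= d%:R :> R by [].
(* [h <= 1 / 6] gives relative increments of size at most [3 * h <= 1 / 2] when [chi] is 1; the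
   other entry absorbs the errors [5 * h * d] and [27 * h * d] of the second and third moments. *)
pose h := Num.min 6^-1 (e / (54 * (d%:R + 1))).
have d1 : 0 < 54 * (d%:R + 1) :> R by rewrite mulr_gt0// ltr_wpDl.
have h0 : 0 < h by rewrite lt_min invr_gt0 divr_gt0//= ltr0n.
have h6 : 6 * h <= 1 by rewrite -ler_pdivlMl// mulr1 ge_min lexx.
have hd : 54 * (h * d%:R) <= e.
  have : h <= e / (54 * (d%:R + 1)) by rewrite ge_min lexx orbT.
  by rewrite ler_pdivlMr// => ?; have := mulr_ge0 (ltW h0) dd0; lra.
clearbody h.
have ee0 : 0 < e * h / (8 * C) by rewrite divr_gt0 ?mulr_gt0.
have [K HK] := sqnorm_tail htheta ee0.
have et0 : 0 < e * h ^+ 4 / C ^+ 2 by rewrite divr_gt0 ?mulr_gt0 ?exprn_gt0.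
have [s0 s01 Hs] := jump_tail_bound htheta et0.
have s00 : 0 < s0 := lt_le_trans ltr01 s01.
have h2 : 0 < h ^+ 2 by rewrite exprn_gt0.
exists (Num.max 1 (Num.max (K * C / h ^+ 2) (s0 ^+ 2 * C / h ^+ 2))).
  by rewrite le_max lexx.
move=> x; rewrite !ge_max => /and3P[q1]; rewrite ler_pdivrMr// => qK.
rewrite ler_pdivrMr// => qs.
set q := nsq x in q1 qK qs *.
have q0 : 0 < q := lt_le_trans ltr01 q1.
pose chi (y : Zd d) : R := (nsq y <= h ^+ 2 * q)%R%:R.
have rE y : relinc nsq x y = (nsq y - 2 * dotv (nvec x) (nvec y)) / q.
  by rewrite /relinc nsqB -/q; congr (_ / _); ring.
pose b (y : Zd d) := dotv (nvec x) (nvec y).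
have CS y : b y ^+ 2 <= q * nsq y by exact: cauchy_schwarz.
have small y : nsq y <= h ^+ 2 * q -> `|b y| <= h * q.
  move=> Ty; rewrite -ler_sqr ?nnegrE ?mulr_ge0 ?(ltW h0) ?(ltW q0)//.
  rewrite real_normK ?num_real//; apply: (le_trans (CS y)).
  have -> : (h * q) ^+ 2 = q * (h ^+ 2 * q) by ring.
  by rewrite ler_wpM2l ?(ltW q0).
have N0 y := nsq_ge0 y.
have chiP y : chi y = 1 /\ nsq y <= h ^+ 2 * q \/ chi y = 0 /\ h ^+ 2 * q < nsq y.
  by rewrite /chi; case: leP => H; [left|right].
have hle1 : h <= 1 by lra.
have h2h : h ^+ 2 * q <= h * q.
  by rewrite ler_wpM2r ?(ltW q0)// expr2 ler_piMr ?(ltW h0).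
(* By Cauchy-Schwarz [(h * b y) ^+ 2 <= h ^+ 2 * q * nsq y], which is at most [nsq y ^+ 2] for a
   large jump. *)
have big y : h ^+ 2 * q < nsq y -> `|nsq y - 2 * b y| <= 3 / h * nsq y.
  move=> Ty; have hb : `|h * b y| <= nsq y.
    rewrite -ler_sqr ?nnegrE//= real_normK ?num_real// exprMn.
    apply: (@le_trans _ _ (h ^+ 2 * (q * nsq y))); first by rewrite ler_wpM2l ?sqr_ge0.
    by rewrite mulrA expr2 ler_wpM2r// ltW.
  rewrite mulrAC ler_pdivlMr// mulrC -{1}(gtr0_norm h0) -normrM.
  have /ler_normlP[hb1 hb2] := hb.
  have hN : h * nsq y <= nsq y by rewrite ler_piMl.
  have hN0 : 0 <= h * nsq y by rewrite mulr_ge0// ltW.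
  by rewrite mulrBr mulrCA ler_norml; lra.
have rsmall y : nsq y <= h ^+ 2 * q -> `|relinc nsq x y| <= 3 * h.
  move=> Ty; rewrite rE normrM normfV (gtr0_norm q0) ler_pdivrMr// -/(b y).
  have /ler_normlP[h1 h3] := small y Ty.
  by have := N0 y; rewrite ler_norml; move: h2h Ty; lra.
have igbig : ig (fun y => (1 - chi y) * nsq y).
  apply: (le_ig mZ (g := nsq)); last exact: ig_nsq.
  move=> y; case: (chiP y) => -[-> _]; first by rewrite subrr mul0r normr0.
  by rewrite subr0 mul1r ger0_norm.
have delta : \int[theta]_y ((1 - chi y) * nsq y) <= e * h / 8.
  have igK : ig (fun y => sqnorm y * \1_[set y | K < sqnorm y] y).
    apply: (le_ig mZ (g := @sqnorm R d)); last exact: ig_sqnorm.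
    move=> y; rewrite indicE; have s0_ := sqnorm_ge0 (R := R) y.
    by case: (_ \in _); rewrite ?mulr1 ?mulr0 ?normr0// ger0_norm.
  apply: (@le_trans _ _ (C * (e * h / (8 * C)))); last first.
    by rewrite (_ : C * _ = e * h / 8)//; field; exact: lt0r_neq0.
  apply: le_trans (ler_wpM2l (ltW C0) HK); rewrite -EZ//.
  apply: E_le => //; first exact: igZ.
  move=> y; have s0_ := sqnorm_ge0 (R := R) y; case: (chiP y) => -[-> Ty].
    by rewrite subrr mul0r mulr_ge0 ?(ltW C0)// mulr_ge0// indicE.
  rewrite subr0 mul1r indicE mem_set ?mulr1//=.
  rewrite -(ltr_pM2r C0); apply: le_lt_trans qK _.
  by rewrite mulrC [sqnorm y * C]mulrC; apply: lt_le_trans Ty (HC y).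
exists chi; split.
- move=> y; case: (chiP y) => -[-> Ty]; [right|by left].
  by split=> //; apply: le_trans (rsmall y Ty) _; lra.
- rewrite -EZ; last first.
    apply: (@ig_bounded _ _ _ mZ theta 1) => y.
    case: (chiP y) => -[-> Ty]; rewrite ?mul0r ?normr0// mul1r.
    by apply: le_trans (rsmall y Ty) _; lra.
  have ib : ig (fun y => nsq y - 2 * b y).
    by apply: igB; [exact: ig_nsq|apply: igZ; exact: ig_ndot].
  (* Without [chi] the mean is exactly [d]; the error comes from the large jumps alone and is
     bounded by [big] and [delta]. *)
  have Eb : \int[theta]_y (nsq y - 2 * b y) = d%:R.
    rewrite EB; [|exact: ig_nsq|by apply: igZ; exact: ig_ndot].
    by rewrite E_nsq EZ ?E_ndot ?mulr0 ?subr0//; exact: ig_ndot.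
  rewrite -Eb -EB//; last first.
    apply: (@ig_bounded _ _ _ mZ theta q) => y.
    rewrite normrM (gtr0_norm q0) ler_piMr ?(ltW q0)//.
    case: (chiP y) => -[-> Ty]; rewrite ?mul0r ?normr0// mul1r.
    by apply: le_trans (rsmall y Ty) _; lra.
  apply: (@le_trans _ _ (\int[theta]_y (3 / h * ((1 - chi y) * nsq y)))).
    apply: (E_abs_le mZ); last exact: igZ.
    move=> y; case: (chiP y) => -[-> Ty].
      by rewrite mul1r rE mulrCA mulfV ?lt0r_neq0// mulr1 !subrr mul0r mulr0 normr0.
    by rewrite mul0r mulr0 sub0r normrN subr0 mul1r big.
  rewrite EZ//; apply: (@le_trans _ _ (3 / h * (e * h / 8))).
    by rewrite ler_wpM2l// divr_ge0// ltW.
  have -> : 3 / h * (e * h / 8) = 3 / 8 * e by field; exact: lt0r_neq0.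
  by lra.
- have i2 : ig (fun y => chi y * relinc nsq x y ^+ 2).
    apply: (@ig_bounded _ _ _ mZ theta 1) => y.
    case: (chiP y) => -[-> Ty]; rewrite ?mul0r ?normr0// mul1r normrX.
    by rewrite exprn_ile1//; apply: le_trans (rsmall y Ty) _; lra.
  have ib : ig (fun y => b y * b y) by exact: ig_ndot2.
  (* The main part of [q * r ^+ 2] is [4 / q * b ^+ 2], with mean exactly 4. *)
  have E4 : \int[theta]_y (4 / q * (b y * b y)) = 4.
    by rewrite EZ// E_ndot2 -/(nsq x) -/q divfK// lt0r_neq0.
  rewrite -[X in _ - X]E4 -EZ// -EB//; [|exact: igZ|exact: igZ].
  have ig1 : ig (fun y => 5 * h * nsq y) by apply: igZ; exact: ig_nsq.
  have ig2 : ig (fun y => 4 * ((1 - chi y) * nsq y)) by exact: igZ.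
  apply: (@le_trans _ _ (\int[theta]_y (5 * h * nsq y + 4 * ((1 - chi y) * nsq y)))).
    apply: (E_abs_le mZ); last exact: igD.
    move=> y; case: (chiP y) => -[-> Ty].
      rewrite rE -/(b y) subrr mul0r mulr0 addr0 mul1r.
      have -> : q * ((nsq y - 2 * b y) / q) ^+ 2 - 4 / q * (b y * b y) =
          nsq y / q * (nsq y - 4 * b y).
        by move: (nsq y) (b y) => N' b'; field; exact: lt0r_neq0.
      rewrite normrM ger0_norm ?divr_ge0 ?(ltW q0)//.
      have n5 : `|nsq y - 4 * b y| <= 5 * h * q.
        have /ler_normlP[h1 h3] := small y Ty.
        by have := N0 y; rewrite ler_norml; move: h2h Ty; lra.
      apply: le_trans (ler_wpM2l _ n5) _; first by rewrite divr_ge0 ?(ltW q0).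
      by rewrite [5 * h * q]mulrC mulrA divfK ?lt0r_neq0// mulrC.
    rewrite mul0r mulr0 sub0r normrN subr0 mul1r -expr2 ger0_norm; last first.
      by rewrite mulr_ge0 ?sqr_ge0// divr_ge0 ?(ltW q0).
    apply: (@le_trans _ _ (4 * nsq y)); last by rewrite lerDr !mulr_ge0// ltW.
    by rewrite -mulrA ler_wpM2l// mulrC ler_pdivrMr// mulrC.
  rewrite ED// !EZ//; last exact: ig_nsq.
  by rewrite E_nsq; have := mulr_ge0 (ltW h0) dd0; have := mulr_gt0 e0 h0; move: delta hd h6; nra.
- have i3 : ig (fun y => chi y * `|relinc nsq x y| ^+ 3).
    apply: (@ig_bounded _ _ _ mZ theta 1) => y.
    case: (chiP y) => -[-> Ty]; rewrite ?mul0r ?normr0// mul1r normrX normr_id.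
    by rewrite exprn_ile1//; apply: le_trans (rsmall y Ty) _; lra.
  have ig1 : ig (fun y => 27 * h * nsq y) by apply: igZ; exact: ig_nsq.
  rewrite -EZ//; apply: (@le_trans _ _ (\int[theta]_y (27 * h * nsq y))).
    apply: E_le => //; first exact: igZ.
    move=> y; case: (chiP y) => -[-> Ty]; last first.
      by rewrite mul0r mulr0 !mulr_ge0// ltW.
    have qr : q * `|relinc nsq x y| ^+ 2 <= 9 * nsq y.
      rewrite real_normK ?num_real// rE -/(b y).
      have -> : q * ((nsq y - 2 * b y) / q) ^+ 2 = (nsq y - 2 * b y) ^+ 2 / q.
        by move: (nsq y) (b y) => N' b'; field; exact: lt0r_neq0.
      rewrite ler_pdivrMr//; have := CS y; have := sqr_ge0 (nsq y + 2 * b y).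
      have : nsq y * nsq y <= q / 2 * nsq y.
        apply: ler_wpM2r => //; apply: (le_trans Ty).
        by rewrite mulrC ler_wpM2l ?(ltW q0)// expr2; nra.
      by move: (nsq y) (b y) => N' b'; nra.
    rewrite mul1r exprS mulrCA.
    apply: (@le_trans _ _ (3 * h * (9 * nsq y))); last by lra.
    apply: ler_pM => //; last exact: rsmall.
    by rewrite mulr_ge0// ltW.
  by rewrite EZ; [rewrite E_nsq; move: hd e0; lra|exact: ig_nsq].
(* [chi] can vanish only on jumps longer than [s], and [s ^+ 4] is proportional to [q ^+ 2], which
   matches the fourth-order tail. *)
- pose s := Num.sqrt (h ^+ 2 * q / C).
  have hq0 : 0 < h ^+ 2 * q / C by rewrite divr_gt0// mulr_gt0.
  have s2 : s ^+ 2 = h ^+ 2 * q / C by rewrite sqr_sqrtr// ltW.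
  have s0s : s0 <= s.
    rewrite -ler_sqr ?nnegrE ?sqrtr_ge0 ?(ltW s00)// s2 ler_pdivlMr//.
    by rewrite [h ^+ 2 * q]mulrC.
  have := Hs s s0s; set pt := fine _ => Hpt.
  have le_pt : \int[theta]_y (1 - chi y) <= pt.
    rewrite /pt -E_indic; apply: E_le; last 1 first.
    - move=> y; case: (chiP y) => -[-> Ty]; first by rewrite subrr indicE.
      rewrite subr0 indicE mem_set//= s2 ltr_pdivrMr//.
      by apply: lt_le_trans Ty _; rewrite mulrC.
    - apply: (@ig_bounded _ _ _ mZ theta 1) => y.
      by case: (chiP y) => -[-> _]; rewrite ?subrr ?subr0 ?normr0 ?normr1.
    - exact: ig_indic.
  apply: le_trans (ler_wpM2l (sqr_ge0 q) le_pt) _.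
  have c0 : 0 < h ^+ 4 / C ^+ 2 by rewrite divr_gt0 ?exprn_gt0.
  rewrite -(ler_pM2r c0); apply: le_trans _ (_ : e * h ^+ 4 / C ^+ 2 <= _).
    apply: le_trans Hpt; rewrite (exprM s 2 2) s2.
    by rewrite (_ : (h ^+ 2 * q / C) ^+ 2 * pt = q ^+ 2 * pt * (h ^+ 4 / C ^+ 2))//; field; exact: lt0r_neq0.
  by rewrite -mulrA.
Qed.

End normalised_walk.

(** * Positivity of the hitting probabilities *)

Lemma seq_lower_bound {R : realFieldType} {T : eqType} (f : T -> R) (r : seq T) :
  (forall x, x \in r -> 0 < f x) -> exists2 m, 0 < m & forall x, x \in r -> m <= f x.
Proof.
elim: r => [_|x r IH H]; first by exists 1.
have [|m m0 Hm] := IH; first by move=> y yr; apply: H; rewrite inE yr orbT.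
exists (Num.min (f x) m); first by rewrite lt_min m0 H// inE eqxx.
move=> y; rewrite inE => /predU1P[->|/Hm]; first by rewrite ge_min lexx.
by apply: le_trans; rewrite ge_min lexx orbT.
Qed.

Section generation.
Context {R : realType} {d : nat}.
Variable theta : probability (Zd d) R.
Hypothesis htheta : jump_assumptions theta.

Local Notation ig f := (theta.-integrable setT (EFin \o f)).
Local Notation mZ := (@Zd_measurable d).
Local Notation vec x := (Zd_to_R R x).

Definition atom_mass y : R := fine (theta [set y]).
Local Notation q := atom_mass.

Lemma atoms_full (A : set (Zd d)) : (forall y, 0 < q y -> A y) -> theta A = 1%E.
Proof.
move=> HA.
have A0 : \int[theta]_y \1_(~` A) y = 0.
  rewrite /Rintegral (integral_discrete mZ theta (pcan_inj (@pickleK _)))//.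
  rewrite (esum1 (D := setT))// => y _; rewrite indicE.
  have [/set_mem Ay|_] := boolP (y \in ~` A); last by rewrite mul0r.
  rewrite mul1r; congr EFin; apply/le_anti; rewrite fine_ge0// andbT leNgt.
  by apply/negP => /HA.
have mA := mZ A; have := probability_setC theta mA.
rewrite E_indic in A0; rewrite -(fineK (fin_num_measure theta _ (mZ (~` A)))) A0.
rewrite -[X in (_ = _ - X)%E](fineK (fin_num_measure theta _ mA)) => -[] /esym.
move=> /eqP; rewrite subr_eq0 => /eqP e1.
by rewrite -(fineK (fin_num_measure theta _ mA)) -e1.
Qed.

Lemma atoms_generate (H : set (Zd d)) : H 0 ->
  (forall x y, H x -> H y -> H (x - y)) -> (forall y, 0 < q y -> H y) ->
  forall x, H x.
Proof.
move=> H0 HB Hq x.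
have zH : zmod_closed [pred x | `[< H x >]].
  by split=> [|y z /asboolP Hy /asboolP Hz]; apply/asboolP => //; exact: HB.
have := jump_not_in_strict_subgroup htheta zH.
have -> : [set x | x \in [pred x | `[< H x >]]] = H.
  by apply/seteqP; split=> y /=; [move/asboolP|move=> ?; apply/asboolP].
by move=> /(_ (atoms_full Hq))/(_ x) /= h; apply/asboolP; rewrite -[asbool _]/(x \in [pred x | `[< H x >]]) h.
Qed.

Definition atom_sum c := exists2 s : seq (Zd d),
  forall y, y \in s -> 0 < q y & c = \sum_(y <- s) y.

Lemma atom_sum0 : atom_sum 0.
Proof. by exists [::] => //; rewrite big_nil. Qed.

Lemma atom_sumD a b : atom_sum a -> atom_sum b -> atom_sum (a + b).
Proof.
move=> [s Hs ->] [t Ht ->]; exists (s ++ t); last by rewrite big_cat.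
by move=> y; rewrite mem_cat => /orP[/Hs|/Ht].
Qed.

Lemma atom_sum1 y : 0 < q y -> atom_sum y.
Proof. by exists [:: y]; [move=> z; rewrite inE => /eqP ->|rewrite big_seq1]. Qed.

Lemma atom_sum_big I (s : seq I) (P : pred I) F :
  (forall i, P i -> atom_sum (F i)) -> atom_sum (\sum_(i <- s | P i) F i).
Proof. by move=> H; elim/big_ind: _ => //; [exact: atom_sum0|exact: atom_sumD]. Qed.

Lemma atom_sumMn c n : atom_sum c -> atom_sum (c *+ n).
Proof.
move=> Hc; elim: n => [|n IH]; first by rewrite mulr0n; exact: atom_sum0.
by rewrite mulrS; exact: atom_sumD.
Qed.

(** Differences of elements of the semigroup form a subgroup containing all atoms. *)
Lemma atom_sum_difference x : exists2 c, atom_sum c & atom_sum (x + c).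
Proof.
apply: (@atoms_generate (fun x => exists2 c, atom_sum c & atom_sum (x + c))).
- by exists 0; rewrite ?addr0; exact: atom_sum0.
- move=> y z [b Hb Hyb] [c Hc Hzc]; exists (b + (z + c)); first exact: atom_sumD.
  have -> : y - z + (b + (z + c)) = (y + b) + c by rewrite addrACA addKr.
  exact: atom_sumD.
- by move=> y qy; exists 0; rewrite ?addr0; [exact: atom_sum0|exact: atom_sum1].
Qed.

Definition l1norm (v : Zd d) : nat := (\sum_i absz (v i ord0))%N.

(** Each signed basis vector enters the semigroup after adding some element of it; [k] collects
    these elements. Any error vector can then be absorbed at a cost proportional to its [l1norm]. *)
Lemma atom_sum_absorb : exists2 k, atom_sum k & forall v, atom_sum (v + k *+ l1norm v).
Proof.
pose e (p : 'I_d * bool) : Zd d := (-1) ^+ p.2 *: delta_mx p.1 0.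
have /choice[f Hf] : forall p, exists c, atom_sum c /\ atom_sum (e p + c).
  by move=> p; have [c ? ?] := atom_sum_difference (e p); exists c.
exists (\sum_p f p) => [|v]; first by apply: atom_sum_big => p _; case: (Hf p).
have He p : atom_sum (e p + \sum_p f p).
  rewrite (bigD1 p)//= addrA; apply: atom_sumD; first by case: (Hf p).
  by apply: atom_sum_big => p' _; case: (Hf p').
set k := \sum_p f p in He *.
rewrite {1}(matrix_sum_delta v) /l1norm -sumrMnr -big_split; apply: atom_sum_big => i _.
rewrite big_ord1 /=.
have -> : v i ord0 *: delta_mx i ord0 + k *+ absz (v i ord0) =
    (e (i, v i ord0 < 0) + k) *+ absz (v i ord0).
  rewrite mulrnDl; congr (_ + _); rewrite /e /= -scaler_nat scalerA; congr (_ *: _).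
  by rewrite {1}(intEsign (v i ord0)) mulrC natz.
exact: atom_sumMn.
Qed.

Lemma mulrn_cancel (V : zmodType) (x : V) n a b : (a + b <= n)%N ->
  x *+ (n - a - b) + (x *- n + x *+ b) = x *- a.
Proof.
move=> h; rewrite -subnDA mulrnBr// addrACA subrr add0r mulrnDr opprD.
by rewrite subrK.
Qed.

Lemma sum_count_uniq (s F : seq (Zd d)) : uniq F -> {subset s <= F} ->
  \sum_(y <- F) y *+ count_mem y s = \sum_(y <- s) y.
Proof.
move=> uF; elim: s => [_|x s IH sF].
  by rewrite big_nil big1.
rewrite big_cons -IH; last by move=> y ys; apply: sF; rewrite inE ys orbT.
under eq_bigr do rewrite /= mulrnDr.
rewrite big_split; congr (_ + _).
rewrite (bigD1_seq x)//=; last by apply: sF; rewrite inE eqxx.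
by rewrite eqxx big1 ?addr0// => y yx; rewrite eq_sym (negPf yx).
Qed.

(** As [theta] is centred, the drift carried by [F] is minus the drift outside [F]. Along an
    enumeration of the lattice the latter tends to 0, being dominated by the integrable
    [1 + sqnorm]. *)
Lemma small_drift e (s : seq (Zd d)) : 0 < e -> exists F : seq (Zd d),
  [/\ uniq F, {subset s <= F} &
      forall i, `|\sum_(y <- F) q y * vec y i 0| <= e].
Proof.
move=> e0.
pose F n := undup (s ++ pmap (@unpickle (Zd d)) (iota 0 n)).
pose h (y : Zd d) : R := cst 1 y + sqnorm y.
have h0 y : 0 <= h y by rewrite addr_ge0 ?sqnorm_ge0.
have igh : ig h by apply: igD; [exact: ig_cst|exact: ig_sqnorm].
pose hn n y : R := h y * \1_[set z | z \notin F n] y.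
have hn_le n y : `|hn n y| <= h y.
  rewrite normrM (ger0_norm (h0 y)) indicE.
  by case: (_ \in _); rewrite ?normr1 ?normr0 ?mulr1 ?mulr0.
have ighn n : ig (hn n) by apply: (le_ig mZ (g := h)).
have [] := @dominated_convergence _ _ _ theta setT measurableT
  (fun n y => (hn n y)%:E) (fun=> 0%E) (EFin \o h).
- by move=> n ? ? ?; exact: mZ.
- by move=> ? ? ?; exact: mZ.
- apply: aeW => y _; apply: (@cvg_near_cst _ _ _ _ _ _).
  exists (pickle y).+1 => // n /= yn.
  rewrite /hn indicE memNset ?mulr0//= => /negP; apply.
  rewrite mem_undup mem_cat; apply/orP; right.
  by rewrite mem_pmap; apply/mapP; exists (pickle y); rewrite ?mem_iota ?pickleK.
- exact: igh.
- by apply: aeW => y n _ /=; rewrite lee_fin.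
move=> _ _; rewrite integral0 => /fine_cvg /cvgrPdist_le /(_ e e0) [n _ /(_ n (leqnn _))] /=.
rewrite sub0r normrN => hne; exists (F n); split; first exact: undup_uniq.
  by move=> y ys; rewrite mem_undup mem_cat ys.
move=> i; have igi : ig (fun y => vec y i 0) by exact: ig_coord.
have igz z : ig (fun y => vec z i 0 * \1_[set z] y) by apply: igZ; exact: ig_indic.
have -> : \sum_(y <- F n) q y * vec y i 0 =
    \int[theta]_y (\sum_(z <- F n) vec z i 0 * \1_[set z] y).
  rewrite E_sum//; apply: eq_bigr => z _; rewrite EZ; last exact: ig_indic.
  by rewrite E_indic mulrC.
rewrite -[X in `|X|]subr0 -[X in _ - X](E_coord htheta i).
rewrite -EB; [|exact: ig_sum|exact: igi].
apply: le_trans hne; rewrite [leRHS]ger0_norm; last first.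
  by apply: Rintegral_ge0 => y _; rewrite mulr_ge0// indicE.
apply: (E_abs_le mZ) => // y; rewrite /hn indicE.
have [yF|yF] := boolP (y \in F n).
  rewrite memNset ?mulr0 /=; last by rewrite yF.
  rewrite (bigD1_seq y) ?undup_uniq//= big1 => [|z zy].
    by rewrite indicE mem_set// mulr1 addr0 subrr normr0.
  by rewrite indicE memNset ?mulr0//= => /esym/eqP; rewrite (negPf zy).
rewrite mem_set// mulr1 big1_seq => [|z /andP[_ zF]]; last first.
  by rewrite indicE memNset ?mulr0//= => yz; rewrite yz zF in yF.
rewrite sub0r normrN.
have := cauchy_schwarz (delta_mx i 0) (vec y).
rewrite !dotv_delta [delta_mx i 0 i 0]mxE !eqxx mul1r -/(sqnorm y) /h /=.
move: (vec y i 0) (sqnorm y) => a b.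
by rewrite ler_norml => ab; have := sqr_ge0 (a - 1); have := sqr_ge0 (a + 1); nra.
Qed.

Lemma vec_coord (x : Zd d) (i : 'I_d) : vec x i 0 = (x i 0)%:~R.
Proof. by rewrite mxE. Qed.

Lemma l1normN (v : Zd d) : l1norm (- v) = l1norm v.
Proof. by apply: eq_bigr => i _; rewrite mxE abszN. Qed.

(* As [theta] is centred, [w = \sum_(y <- F) y *+ floor (n * q y)] has norm at
   most [e * n + O(1)] for [F] large. With [k] absorbing, [- w + k *+ l1norm w] is
   a sum of atoms, and so is [w - y0 - k *+ l1norm w] since its multiplicities
   are still nonnegative; they add up to [- y0]. *)
Lemma atom_sumN y0 : 0 < q y0 -> atom_sum (- y0).
Proof.
move=> qy0; have [k [s Hs kE] Hk] := atom_sum_absorb.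
have [t t0 Ht] : exists2 t, 0 < t & forall y, y \in y0 :: s -> t <= q y.
  by apply: seq_lower_bound => y; rewrite inE => /predU1P[->//|]; exact: Hs.
pose m : R := (size s)%:R; have m0 : 0 <= m by [].
pose e := t / (2 * (d%:R + 1) * (m + 1)).
have d1 : 0 < d%:R + 1 :> R by rewrite ltr_wpDl.
have m1 : 0 < m + 1 by rewrite ltr_wpDl.
have e0 : 0 < e by rewrite divr_gt0// !mulr_gt0.
have [F [uF sF HF]] := small_drift (y0 :: s) e0.
pose CF : R := \sum_i \sum_(y <- F) `|vec y i 0|.
have CF0 : 0 <= CF by apply: sumr_ge0 => i _; apply: sumr_ge0.
pose n := (Num.truncn ((CF * m + 2) * 2 / t)).+1.
have Hn : (CF * m + 2) * 2 < n%:R * t by rewrite -ltr_pdivrMr// truncnS_gt.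
pose ny y := Num.truncn (n%:R * q y).
have q0 y : 0 <= q y by rewrite fine_ge0.
have nq0 y : 0 <= n%:R * q y by rewrite mulr_ge0.
have ny_le y : (ny y)%:R <= n%:R * q y by rewrite truncn_le.
have ny_gt y : n%:R * q y < (ny y)%:R + 1 by rewrite natr1 truncnS_gt.
pose w := \sum_(y <- F) y *+ ny y; pose W := l1norm w.
have Wle : W%:R <= d%:R * (n%:R * e) + CF.
  rewrite /W /l1norm natr_sum; apply: (@le_trans _ _ (\sum_(i < d) (n%:R * e + \sum_(y <- F) `|vec y i 0|))).
    apply: ler_sum => i _.
    rewrite natr_absz intr_norm /w summxE raddf_sum/=.
    have -> : \sum_(y <- F) ((y *+ ny y) i ord0)%:~R =
        n%:R * \sum_(y <- F) q y * vec y i 0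
        - \sum_(y <- F) (n%:R * q y - (ny y)%:R) * vec y i 0.
      rewrite mulr_sumr -sumrB; apply: eq_bigr => y _.
      by rewrite mulrA mulrBl opprB addrC subrK vec_coord mulmxnE rmorphMn -mulr_natl.
    apply: le_trans (ler_normB _ _) _; apply: lerD.
      by rewrite normrM ger0_norm// ler_wpM2l.
    apply: le_trans (ler_norm_sum _ _ _) _; apply: ler_sum => y _.
    rewrite normrM ler_piMl// ger0_norm; have := ny_le y; have := ny_gt y; lra.
  by rewrite big_split /= sumr_const card_ord -[X in X + _]mulr_natl.
(* Only points of [y0 :: s] lose copies, and they have mass at least [t]. By the choice of [e], the
   part of [W * m] linear in [n] is at most [n * t / 2]; the other half absorbs [CF * m] and the
   rounding. *)
have nb y : y \in F -> ((y == y0) + W * count_mem y s <= ny y)%N.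
  move=> yF; have [ys|ys] := boolP (y \in y0 :: s); last first.
    move: ys; rewrite inE negb_or => /andP[/negPf -> /count_memPn ->].
    by rewrite muln0.
  apply: (@leq_trans (1 + W * size s)).
    by rewrite leq_add ?leq_b1// leq_mul2l count_size orbT.
  rewrite -ltnS -(ltr_nat R) -[(ny y).+1%:R]natr1; apply: le_lt_trans (ny_gt y).
  apply: (@le_trans _ _ (n%:R * t)); last by rewrite ler_wpM2l// Ht.
  rewrite natrD natrM -/m.
  have h1 : W%:R * m <= (d%:R * (n%:R * e) + CF) * m by rewrite ler_wpM2r.
  have h2 : d%:R * (n%:R * e) * m <= n%:R * t / 2.
    have -> : n%:R * t / 2 = n%:R * e * ((d%:R + 1) * (m + 1)).
      by rewrite /e; field; rewrite !lt0r_neq0.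
    have ne0 : 0 <= n%:R * e by rewrite mulr_ge0// ltW.
    rewrite -mulrA mulrCA ler_wpM2l// mulrC; have d0 : 0 <= d%:R :> R by [].
    by nra.
  by lra.
have -> : - y0 = (\sum_(y <- F) y *+ (ny y - (y == y0) - W * count_mem y s))
    + (- w + k *+ l1norm (- w)).
  rewrite l1normN -/W kE -(sum_count_uniq uF); last first.
    by move=> y ys; apply: sF; rewrite inE ys orbT.
  rewrite -sumrMnl -sumrN -!big_split /=.
  rewrite [RHS](eq_big_seq (fun y => - (y *+ (y == y0)))) => [|y yF].
    rewrite sumrN (bigD1_seq y0)//=; last by apply: sF; rewrite inE eqxx.
    by rewrite eqxx big1 ?addr0// => y /negPf ->.
  by rewrite -mulrnA [(count_mem y s * W)%N]mulnC mulrn_cancel// nb.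
apply: atom_sumD; last exact: Hk.
apply: atom_sum_big => y _; have [qy|] := ltP 0 (q y).
  by apply: atom_sumMn; exact: atom_sum1.
move=> qy; have -> : ny y = 0%N; last by rewrite sub0n mulr0n; exact: atom_sum0.
by rewrite /ny (_ : q y = 0) ?mulr0 ?truncn0//; apply/le_anti; rewrite qy q0.
Qed.

Lemma atom_sum_all x : atom_sum x.
Proof.
apply: atoms_generate x; first exact: atom_sum0; last exact: atom_sum1.
move=> x y Hx [s Hs ->]; apply: atom_sumD => //.
rewrite -sumrN big_seq; apply: atom_sum_big => z zs; apply: atom_sumN; exact: Hs.
Qed.

End generation.

Section positivity.
Context {R : realType} {d : nat}.
Variables (mu : probability nat R) (theta : probability (Zd d) R).
Hypotheses (hmu : offspring_assumptions mu) (htheta : jump_assumptions theta).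
Local Notation vec x := (Zd_to_R R x).

(** Induction along a sum of atoms: the average at a point is at least the mass of one atom times
    [u] at the previous partial sum, and [hitfun] preserves positivity. *)
Lemma hitting_gt0 (u : Zd d -> R) : (forall x, 0 <= u x <= 1) -> u 0 = 1 ->
  (forall x, x != 0 -> u x = hitfun mu (\int[theta]_y u (x - y))) ->
  forall x, 0 < u x.
Proof.
move=> u01 u0 Hu x; have [s Hs ->] := atom_sum_all htheta x.
elim: s Hs => [_|y s IH Hs]; first by rewrite big_nil u0.
have /IH us : forall z, z \in s -> 0 < atom_mass theta z.
  by move=> z zs; apply: Hs; rewrite inE zs orbT.
have qy : 0 < atom_mass theta y by apply: Hs; rewrite inE eqxx.
rewrite big_cons; have [->|z0] := eqVneq (y + \sum_(j <- s) j) 0; first by rewrite u0.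
set z := y + _ in z0 *.
rewrite Hu//; apply: hitfun_gt0 => //.
have uz y' : 0 <= u (z - y') <= 1 by [].
have /andP[_ ->] := E_in01 (@Zd_measurable d) theta uz; rewrite andbT.
have uz0 y' : 0 <= u (z - y') by case/andP: (uz y').
have := atom_le_E (@Zd_measurable d) (pcan_inj (@pickleK _)) y uz0 (ig_in01 theta uz).
by apply: lt_le_trans; rewrite mulr_gt0// /z addrAC subrr add0r.
Qed.

Lemma absz_sqr_le_sqnorm (x : Zd d) i : ((absz (x i ord0)) ^ 2)%:R <= sqnorm x :> R.
Proof.
apply: (@le_trans _ _ ((vec x i 0) ^+ 2)).
  by rewrite mxE natrX natr_absz intr_norm real_normK ?num_real.
rewrite /sqnorm /dotv (bigD1 i)//= -expr2 lerDl sumr_ge0// => j _.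
by rewrite -expr2 sqr_ge0.
Qed.

Lemma sqnorm_ge1 (x : Zd d) : x != 0 -> 1 <= sqnorm x :> R.
Proof.
move=> x0; have [i xi] : exists i, x i ord0 != 0.
  apply/existsP; apply: contra_neqT x0; rewrite negb_exists => /forallP H.
  by apply/colP => i; rewrite mxE; apply/eqP; rewrite -[_ == _]negbK.
apply: le_trans (absz_sqr_le_sqnorm x i).
by rewrite ler1n expn_gt0 absz_gt0 xi.
Qed.

Lemma sqnorm_ball_finite (Q : R) : finite_set [set x : Zd d | sqnorm x < Q].
Proof.
pose n := (Num.truncn Q).+1.
pose g (f : {ffun 'I_d -> 'I_(n + n).+1}) : Zd d := \col_i ((f i)%:Z - n%:Z).
apply: (@sub_finite_set _ _ (g @` setT)); last first.
  by apply: finite_image; exact: finite_finset.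
move=> x /= xQ.
have xn i : (absz (x i ord0) <= n)%N.
  apply: (@leq_trans ((absz (x i ord0)) ^ 2)).
    by case: absz => // k; exact: (@leq_pexp2l k.+1 1 2).
  rewrite -(ler_nat R); apply: (le_trans (absz_sqr_le_sqnorm x i)).
  by apply: ltW; apply: (lt_trans xQ); exact: truncnS_gt.
have bnd i : (absz (x i ord0 + n%:Z)%R < (n + n).+1)%N by have := xn i; lia.
exists [ffun i => Ordinal (bnd i)] => //; apply/colP => i.
rewrite mxE ffunE /=; have := xn i; rewrite -[0 in RHS]/ord0.
by move: (x i ord0) => z; lia.
Qed.

Lemma lower_bound_on_balls (N u : Zd d -> R) (C : R) : 0 < C ->
  (forall x, sqnorm x <= C * N x) -> (forall x, 0 < u x) ->
  forall Q, exists2 m, 0 < m & forall x, N x < Q -> m <= u x.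
Proof.
move=> C0 CN u0 Q; have /finite_seqP[r rE] := sqnorm_ball_finite (C * Q).
have [m m0 Hm] := @seq_lower_bound _ _ u r (fun x _ => u0 x).
exists m => // x xQ; apply: Hm.
have : [set x : Zd d | sqnorm x < C * Q] x.
  by rewrite /=; apply: le_lt_trans (CN x) _; rewrite ltr_pM2l.
by rewrite rE.
Qed.

Lemma cov_mx_sym : (cov_mx theta)^T = cov_mx theta.
Proof.
apply/matrixP => i j; rewrite mxE !(cov_mxE htheta).
by apply: eq_Rintegral => y _; rewrite mulrC.
Qed.

(** If the quadratic form vanishes at [v], all atoms lie in the subgroup orthogonal to [v], which is
    then the whole lattice. *)
Lemma cov_mx_posdef : posdefmx (cov_mx theta).
Proof.
move=> v v0; rewrite -mulmxA -dotvE -(E_dot2 htheta).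
have sq0 y : 0 <= dotv v (vec y) * dotv v (vec y) by rewrite -expr2 sqr_ge0.
rewrite lt_neqAle Rintegral_ge0// andbT eq_sym; apply: contra_neqN v0 => /eqP I0.
have H x : dotv v (vec x) = 0.
  apply: (atoms_generate htheta (H := [set x | dotv v (vec x) = 0])).
  - by rewrite /= /dotv big1// => i _; rewrite !mxE mulr0.
  - move=> y z /= Hy Hz; rewrite -[LHS]/(dotv v (vec (y - z))).
    have -> : vec (y - z) = vec y - vec z by apply/colP => i; rewrite !mxE rmorphB.
    by rewrite dotvBr Hy Hz subrr.
  - move=> y qy /=.
    have := atom_le_E (@Zd_measurable d) (pcan_inj (@pickleK _)) y sq0 (ig_dot2 htheta v v).
    rewrite I0 pmulr_lle0// => h; apply/eqP; rewrite -sqrf_eq0 expr2.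
    by apply/eqP/le_anti; rewrite h sq0.
apply/colP => i; have := H (delta_mx i 0); rewrite mxE /dotv (bigD1 i)//= big1.
  by rewrite !mxE !eqxx mulr1 addr0.
by move=> j ji; rewrite !mxE (negPf ji) mulr0.
Qed.

End positivity.

(** * Symmetric square roots *)

Section interpolation.
Context {F : fieldType}.

Lemma interpolation (g : F -> F) (s : seq F) :
  exists p : {poly F}, forall x, x \in s -> p.[x] = g x.
Proof.
elim: s => [|x s [p Hp]]; first by exists 0.
have [xs|xs] := boolP (x \in s).
  by exists p => y; rewrite inE => /orP[/eqP->|]; exact: Hp.
pose q := \prod_(y <- s) ('X - y%:P).
have qx : q.[x] != 0 by rewrite -/(root q x) root_prod_XsubC.
exists (p + ((g x - p.[x]) / q.[x]) *: q) => y; rewrite hornerD hornerZ.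
rewrite inE => /orP[/eqP->|ys]; first by rewrite divfK// addrC subrK.
have /eqP-> : root q y by rewrite root_prod_XsubC.
by rewrite mulr0 addr0 Hp.
Qed.

Lemma horner_mx_diagonalised n (P : 'M[F]_n.+1) (D : 'rV_n.+1) (p : {poly F}) :
  P \in unitmx -> (forall i, p.[D 0 i] = D 0 i) ->
  horner_mx (invmx P *m diag_mx D *m P) p = invmx P *m diag_mx D *m P.
Proof.
move=> Pu pD; rewrite horner_mx_uconjC// horner_mx_diag.
by do 2!congr (_ *m _); congr diag_mx; apply/rowP => i; rewrite mxE pD.
Qed.

End interpolation.

Section square_root.
Import spectral complex.
Context {R : realType}.

Lemma posdefmx_unit d (S : 'M[R]_d) : posdefmx S -> S \in unitmx.
Proof.
move=> S0; rewrite -row_free_unit -kermx_eq0; apply/rowV0P => v /sub_kermxP vS.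
apply: contraTeq isT => v0; have := S0 v^T.
by rewrite trmx_eq0 trmxK vS mul0mx mxE ltxx => /(_ v0).
Qed.

Lemma eigenvalue_posdef_gt0 d (S : 'M[R]_d) a :
  posdefmx S -> eigenvalue S a -> 0 < a.
Proof.
move=> S0 /eigenvalueP[v vS v0].
have := S0 v^T; rewrite trmx_eq0 trmxK => /(_ v0).
rewrite vS -scalemxAl mxE.
have -> : (v *m v^T) 0 0 = dotv v^T v^T by rewrite dotvE trmxK.
have : 0 < dotv v^T v^T by rewrite lt_def dotvv_eq0 trmx_eq0 v0 dotvv_ge0.
by move=> vv; rewrite pmulr_lgt0.
Qed.

Lemma trmx_horner_mx n (M : 'M[R]_n.+1) p : M^T = M -> (horner_mx M p)^T = horner_mx M p.
Proof.
move=> MT; elim/poly_ind: p => [|p c IH]; first by rewrite rmorph0 trmx0.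
rewrite rmorphD rmorphM/= horner_mx_X horner_mx_C linearD/= tr_scalar_mx trmx_mul IH MT.
congr (_ + _); rewrite -[X in X *m _](horner_mx_X M) -[X in _ = _ * X](horner_mx_X M).
by rewrite mulmxE -!rmorphM/= mulrC.
Qed.

(* A real polynomial [r] interpolating the fourth root at the eigenvalues of [M]
   gives a symmetric [Q = r(M)] with [Q ^+ 4 = M], and [Q ^+ 2] is positive
   definite as the square of an invertible symmetric matrix. *)
Lemma posdef_sqrt_exists d (M : 'M[R]_d) : M^T = M -> posdefmx M ->
  exists S, [/\ S^T = S, posdefmx S & S *m S = M].
Proof.
case: d M => [|n] M MT M0.
  by exists 0; split; [exact: trmx0| move=> v; rewrite (flatmx0 v) eqxx | rewrite mul0mx [M]flatmx0].
pose toC : {rmorphism R -> R[i]} := real_complex R.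
pose A : 'M[R[i]]_n.+1 := map_mx toC M.
have Asym : A \is symmetricmx.
  by apply/is_hermitianmxP; rewrite expr0 scale1r map_mx_id//; apply/matrixP => i j; rewrite !mxE -{1}MT mxE.
have Areal : A \is a mxOver Num.real.
  by apply/mxOverP => i j; rewrite mxE; apply/complex_realP; exists (M i j).
have /orthomx_spectralP := symmetric_normalmx Asym Areal.
set P := spectralmx A; set D := spectral_diag A => AE.
have Pu : P \in unitmx by exact: spectral_unit.
have /mxOverP Dreal := hermitian_spectral_diag_real (realsym_hermsym Asym Areal).
have /choice[lam lamE] i : exists k : R, D 0 i = toC k by apply/complex_realP; exact: Dreal.
have lam0 i : 0 < lam i.
  apply: (eigenvalue_posdef_gt0 M0).
  rewrite -(eigenvalue_map toC M) -lamE.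
  apply/eigenvalueP; exists (row i P); last first.
    apply/eqP => /(congr1 (fun v => (v *m invmx P) 0 i)).
    by rewrite -row_mul mulmxV// row1 mul0mx !mxE !eqxx => /eqP; rewrite oner_eq0.
  rewrite -/A AE -row_mul !mulmxA mulmxV// mul1mx.
  by rewrite row_mul row_diag_mx -scalemxAl -rowE.
have [r Hr] := interpolation root4 [seq lam i | i : 'I_n.+1].
have rE i : r.[lam i] = root4 (lam i) by apply: Hr; apply: map_f; rewrite mem_enum.
pose Q := horner_mx M r.
have Q4 : Q *m Q *m (Q *m Q) = M.
  have -> : Q *m Q *m (Q *m Q) = horner_mx M (r ^+ 4).
    by rewrite rmorphXn/= -/Q !exprS expr0 mulr1 mulrA.
  (* The identity is checked over the complex numbers, where the spectral theorem diagonalises [M]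
     and [r ^+ 4] fixes each eigenvalue. *)
  apply: (@map_mx_inj _ _ toC); rewrite map_horner_mx -/A.
  rewrite AE; apply: horner_mx_diagonalised => // i.
  by rewrite lamE horner_map horner_exp rE root4K// ltW.
have QT : Q^T = Q by exact: trmx_horner_mx.
have Qu : Q \in unitmx.
  by have := posdefmx_unit M0; rewrite -Q4 !unitmx_mul => /andP[/andP[]].
exists (Q *m Q); split => //; first by rewrite trmx_mul QT.
move=> v v0; rewrite !mulmxA -mulmxA -{1}QT -trmx_mul.
rewrite -dotvE lt_def dotvv_ge0 dotvv_eq0 andbT.
by apply: contra v0 => /eqP H; rewrite -[v](mulKmx Qu) H mulmx0.
Qed.

End square_root.

(** * The limit *)

Section limit.
Context {R : realType} {d : nat}.

Lemma sqrtmxP (M : 'M[R]_d) : M^T = M -> posdefmx M ->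
  [/\ (sqrtmx M)^T = sqrtmx M, posdefmx (sqrtmx M) & sqrtmx M *m sqrtmx M = M].
Proof. by move=> MT M0; exact: (xgetPex 0 (posdef_sqrt_exists MT M0)). Qed.

(** Here [s] is the fourth root of [N], so both corrections become of order [1 / s], the lower one
    through [1 / (1 + K / s) >= 1 - K / s]. *)
Lemma barrier_squeeze (c e B K s v : R) : 0 <= c -> 0 < e <= 1 -> 0 <= K -> 0 < s ->
  v <= c * (1 + e) / s ^+ 4 + B / s ^+ 5 ->
  c * (1 - e) / (s ^+ 4 + K * s ^+ 3) <= v ->
  `|c - s ^+ 4 * v| <= c * e + (`|B| + c * K) / s.
Proof.
move=> c0 /andP[e0 e1] K0 s0 up lo.
have s4 : 0 < s ^+ 4 by rewrite exprn_gt0.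
have {}up : s ^+ 4 * v <= c * (1 + e) + B / s.
  have -> : c * (1 + e) + B / s = s ^+ 4 * (c * (1 + e) / s ^+ 4 + B / s ^+ 5).
    by field; rewrite gt_eqF.
  by rewrite ler_pM2l.
have {}lo : c * (1 - e) / (1 + K / s) <= s ^+ 4 * v.
  have -> : c * (1 - e) / (1 + K / s) = s ^+ 4 * (c * (1 - e) / (s ^+ 4 + K * s ^+ 3)).
    have -> : s ^+ 4 + K * s ^+ 3 = s ^+ 4 * (1 + K / s) by field; rewrite gt_eqF.
    by rewrite [RHS]mulrA -mulf_div divff ?mul1r// gt_eqF.
  by rewrite ler_pM2l.
have Ks : 0 <= K / s by rewrite divr_ge0// ltW.
have {}lo : c * (1 - e) - c * (K / s) <= s ^+ 4 * v.
  apply: le_trans lo; rewrite ler_pdivlMr; last by lra.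
  have := mulr_ge0 (mulr_ge0 c0 Ks) (ltW e0); have := mulr_ge0 (mulr_ge0 c0 Ks) Ks.
  by nra.
have Bs : B / s <= `|B| / s by rewrite ler_pM2r ?invr_gt0// ler_norm.
have B0 : 0 <= `|B| / s by rewrite divr_ge0// ltW.
have cK := mulr_ge0 c0 Ks; rewrite ler_norml mulrDl -mulrA; apply/andP; split; lra.
Qed.

Lemma nsq_infty (L : 'M[R]_d) Q : L \in unitmx ->
  \forall a \near Zd_infty R d, Q < nsq L a.
Proof.
move=> /sqnorm_le_nsq[C C0 HC]; exists (1 + `|C * Q|) => // a /= ha.
rewrite -(ltr_pM2l C0); apply: lt_le_trans (HC a).
rewrite /sqnorm -enorm_sq expr2.
have := ler_norm (C * Q); have := normr_ge0 (C * Q); nra.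
Qed.

End limit.

Theorem theorem7 (R : realType) (d : nat)
  (mu : probability nat R) (theta : probability (Zd d) R)
  (hd : (1 <= d <= 3)%N)
  (hmu : offspring_assumptions mu) (htheta : jump_assumptions theta) :
  enorm (invmx (sqrtmx (cov_mx theta)) *m Zd_to_R R a) ^+ 2 *
    fine (Pi_star mu theta [set t | visited t a])
    @[a --> Zd_infty R d] --> (2 * (4 - d%:R) / rho mu ^+ 2 : R).
Proof.
have [ST S0 SS] := sqrtmxP (cov_mx_sym htheta) (cov_mx_posdef htheta).
set S := sqrtmx _ in ST S0 SS *; have Su := posdefmx_unit S0.
set L := invmx S; have Lu : L \in unitmx by rewrite unitmx_inv.
have HL : L *m cov_mx theta *m L^T = 1%:M.
  by rewrite trmx_inv ST -SS mulmxA mulVmx// mul1mx mulmxV.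
have [v [v01 v0 Hv vE]] := hitting_equation theta hmu.
have [C C0 HC] := sqnorm_le_nsq Lu.
have n0 : 0 < C^-1 by rewrite invr_gt0.
have N_ge x : x != 0 -> C^-1 <= nsq L x.
  move=> x0; rewrite -[C^-1]mul1r ler_pdivrMr// mulrC.
  exact: le_trans (sqnorm_ge1 x0) (HC x).
have N_0 : nsq L 0 = 0.
  by rewrite /nsq /nvec /Zd_to_R map_mx0 mulmx0; apply/eqP; rewrite dotvv_eq0.
have D03 : 0 <= (d%:R : R) <= 3 by rewrite ler0n ler_nat; case/andP: hd.
have incr := nsq_increments htheta HL.
have v_gt0 := lower_bound_on_balls C0 HC (hitting_gt0 hmu htheta v01 v0 Hv).
set c := (X in _ --> X); have c0 : 0 <= c.
  by rewrite divr_ge0 ?sqr_ge0// mulr_ge0// subr_ge0; case/andP: D03; lra.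
apply/cvgrPdist_le => eps eps0.
pose e := Num.min 1 (eps / (2 * (c + 1))).
have e01 : 0 < e <= 1 by rewrite lt_min ge_min lexx ltr01 divr_gt0//; lra.
have [B HB] := upper_barrier hmu n0 N_ge D03 incr N_0 v01 v0 Hv e01.
have [K K0 HK] := lower_barrier hmu n0 N_ge D03 incr N_0 v01 Hv v_gt0 e01.
(* Once the fourth root of [N] exceeds [q], the corrections are at most [eps / 2]; the summand 1
   keeps that root positive. *)
pose q := 2 * (`|B| + c * K) / eps + 1.
have BK : 0 <= `|B| + c * K by rewrite addr_ge0// mulr_ge0.
have q1 : 1 <= q by rewrite lerDr divr_ge0 ?(ltW eps0)// mulr_ge0.
have q0 : 0 <= q := le_trans ler01 q1.
near=> a.
have Na : q ^+ 4 < nsq L a by near: a; exact: nsq_infty.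
have Na0 : 0 <= nsq L a by exact: dotvv_ge0.
have a0 : a != 0.
  by apply: contraTneq (Na) => ->; rewrite N_0 -leNgt exprn_ge0.
have qs : q <= root4 (nsq L a).
  rewrite leNgt; apply: contraTN (Na) => sq; rewrite -leNgt -[leLHS]root4K//.
  by rewrite lerXn2r ?nnegrE ?root4_ge0// ltW.
have s0 : 0 < root4 (nsq L a) by exact: lt_le_trans ltr01 (le_trans q1 qs).
rewrite enorm_sq vE -/(nvec L a) -/(nsq L a) -{1}(root4K Na0).
apply: le_trans (barrier_squeeze c0 e01 K0 s0 _ _) _; rewrite ?root4K//; [exact: HB|exact: HK|].
have ce : c * e <= eps / 2.
  apply: (@le_trans _ _ (c * (eps / (2 * (c + 1))))).
    by rewrite ler_wpM2l// ge_min lexx orbT.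
  by rewrite mulrA ler_pdivrMr; nra.
have : (`|B| + c * K) / root4 (nsq L a) <= eps / 2.
  rewrite ler_pdivrMr//; apply: (@le_trans _ _ (eps / 2 * q)).
    have -> : eps / 2 * q = `|B| + c * K + eps / 2 by rewrite /q; field; rewrite gt_eqF.
    by rewrite lerDl divr_ge0// ltW.
  by rewrite ler_wpM2l// divr_ge0// ltW.
by lra.
Unshelve. all: by end_near. Qed.
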